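(* Let $\{\mathcal{M}_i:R_{i-1}\to R_iL_i\}_{i=1}^n$ be channels, let $\rho\in\mathcal{D}_{=}(R_0SE)$, let $\epsilon\in[0,1)$ and $\alpha>1$. Then $$I_{\max}^{\downarrow\downarrow,\epsilon}(SE:L_1^n)_{\mathcal{M}_n\circ\cdots\circ\mathcal{M}_1(\rho_{R_0SE})}\le\sum_{i=1}^n\sup_{\sigma\in\mathcal{D}_{=}(R_{i-1}L_1^{i-1}SE)}I^\downarrow_\alpha(L_1^{i-1}SE;L_i)_{\mathcal{M}_i(\sigma)}-\frac{g(\epsilon)}{\alpha-1},$$ where $g(\epsilon)=\log(1-\sqrt{1-\epsilon^2})$ (so that the right-hand side is $+\infty$ for $\epsilon=0$).
   Context: All registers finite-dimensional, $\log$ base 2; $\mathcal{D}_{=}(A)$, $\mathcal{D}_{\le}(A)$, $\mathrm{Pos}(A)$: normalized states, subnormalized states, positive semidefinite operators on $A$; $L_1^{k}$ denotes $L_1\cdots L_k$. Channels act as identity on registers not named (registers $S,E,L_1,\dots$ are carried along). Sandwiched Rényi divergence: $D_\alpha(\rho\|\sigma)=\frac{1}{\alpha-1}\log\frac{\mathrm{Tr}[(\sigma^{\frac{1-\alpha}{2\alpha}}\rho\sigma^{\frac{1-\alpha}{2\alpha}})^\alpha]}{\mathrm{Tr}\rho}$ if $\mathrm{supp}\rho\subseteq\mathrm{supp}\sigma$ (for $\alpha>1$), else $+\infty$; $D_\infty(\rho\|\sigma)=\log\inf\{\mu\ge0:\rho\le\mu\sigma\}$. $I^\downarrow_\alpha(A;B)_\rho=\inf_{\sigma_B\in\mathcal{D}_{\le}(B)}D_\alpha(\rho_{AB}\|\rho_A\otimes\sigma_B)$.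 Generalized fidelity $F(\rho,\sigma)=\|\sqrt\rho\sqrt\sigma\|_1+\sqrt{(1-\mathrm{Tr}\rho)(1-\mathrm{Tr}\sigma)}$, purified distance $P=\sqrt{1-F^2}$. $I^{\downarrow\downarrow}_\infty(A:B)_\rho=\inf_{\omega_A\in\mathcal{D}_{\le}(A),\sigma_B\in\mathcal{D}_{\le}(B)}D_\infty(\rho_{AB}\|\omega_A\otimes\sigma_B)$ and $I_{\max}^{\downarrow\downarrow,\epsilon}(A:B)_\rho=\inf\{I^{\downarrow\downarrow}_\infty(A:B)_{\tilde\rho}:\tilde\rho\in\mathcal{D}_{\le}(AB),P(\tilde\rho,\rho)\le\epsilon\}$. *)

(* Defs.v *)
From HB Require Import structures.
From mathcomp Require Import all_boot all_order all_algebra.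
From mathcomp Require Import all_classical all_reals all_analysis.
From mathcomp Require Import complex.

Set Implicit Arguments.
Unset Strict Implicit.
Unset Printing Implicit Defensive.

Import Order.TTheory GRing.Theory Num.Theory.
Local Open Scope ring_scope.
Local Open Scope classical_set_scope.

Section QInfo.
Variable R : realType.
Local Notation C := R[i].

Definition cR (x : R) : C := Complex x 0.

Definition log2 (x : R) : R := ln x / ln 2.

(* Linear operators on the Hilbert space C^T of a register with
   (finite) orthonormal basis indexed by T, as matrices T x T. *)
Definition Op (T : finType) := T -> T -> C.

Definition addO {T : finType} (X Y : Op T) : Op T := fun a b => X a b + Y a b.
Definition scaleO {T : finType} (c : C) (X : Op T) : Op T := fun a b => c * X a b.
Definition subO {T : finType} (X Y : Op T) : Op T := fun a b => X a b - Y a b.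
Definition mulO {T : finType} (X Y : Op T) : Op T :=
  fun a b => \sum_c X a c * Y c b.
Definition adjO {T : finType} (X : Op T) : Op T := fun a b => conjc (X b a).
Definition trO {T : finType} (X : Op T) : C := \sum_a X a a.

Definition psd {T : finType} (X : Op T) : Prop :=
  forall v : T -> C, 0 <= \sum_a \sum_b conjc (v a) * X a b * v b.

Definition loewner {T : finType} (X Y : Op T) : Prop := psd (subO Y X).

Definition dens_eq {T : finType} (X : Op T) : Prop := psd X /\ trO X = 1.
Definition dens_le {T : finType} (X : Op T) : Prop := psd X /\ trO X <= 1.

(* supp X included in supp Y (supports = ranges) *)
Definition supp_sub {T : finType} (X Y : Op T) : Prop :=
  forall v : T -> C, exists w : T -> C,
    forall a, \sum_b X a b * v b = \sum_b Y a b * w b.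

Definition specdec {T : finType} (X : Op T) (p : Op T * (T -> R)) : Prop :=
  (forall k l, \sum_a conjc (p.1 a k) * p.1 a l = (k == l)%:R) /\
  X = (fun a b => \sum_k cR (p.2 k) * p.1 a k * conjc (p.1 b k)).

(* functional calculus f(X) for a (Hermitian) operator X, via a spectral
   decomposition (independent of the chosen decomposition). *)
Definition fcalc {T : finType} (f : R -> R) (X : Op T) : Op T :=
  match pselect (exists p, specdec X p) with
  | left e => let p := projT1 (cid e) in
      fun a b => \sum_k cR (f (p.2 k)) * p.1 a k * conjc (p.1 b k)
  | right _ => fun _ _ => 0
  end.

(* X^t on the support of X (generalized power: eigenvalue 0 is mapped to 0) *)
Definition mpow {T : finType} (X : Op T) (t : R) : Op T :=
  fcalc (fun x => if 0 < x then x `^ t else 0) X.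
Definition msqrt {T : finType} (X : Op T) : Op T := fcalc (fun x => Num.sqrt x) X.

Definition trnorm {T : finType} (X : Op T) : R := complex.Re (trO (msqrt (mulO (adjO X) X))).

Definition gfid {T : finType} (X Y : Op T) : R :=
  trnorm (mulO (msqrt X) (msqrt Y)) +
  Num.sqrt ((1 - complex.Re (trO X)) * (1 - complex.Re (trO Y))).
Definition pdist {T : finType} (X Y : Op T) : R := Num.sqrt (1 - gfid X Y ^+ 2).

Definition tensO {A B : finType} (X : Op A) (Y : Op B) : Op (A * B)%type :=
  fun ab ab' => X ab.1 ab'.1 * Y ab.2 ab'.2.
Definition ptr2 {A B : finType} (X : Op (A * B)%type) : Op A :=
  fun a a' => \sum_b X (a, b) (a', b).
Definition ptr1 {A B : finType} (X : Op (A * B)%type) : Op B :=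
  fun b b' => \sum_a X (a, b) (a, b').
Definition swapO {A B : finType} (X : Op (A * B)%type) : Op (B * A)%type :=
  fun ba ba' => X (ba.2, ba.1) (ba'.2, ba'.1).

(* sandwiched Renyi divergence (alpha > 1), extended-real valued *)
Definition Dsand {T : finType} (alpha : R) (rho sigma : Op T) : \bar R :=
  if `[< supp_sub rho sigma >] then
    ((log2 (complex.Re (trO (mpow (mulO (mulO (mpow sigma ((1 - alpha) / (2 * alpha))) rho)
                                  (mpow sigma ((1 - alpha) / (2 * alpha)))) alpha))
            / complex.Re (trO rho))) / (alpha - 1))%:E
  else +oo%E.

Definition Dmax {T : finType} (rho sigma : Op T) : \bar R :=
  ereal_inf [set (log2 mu)%:E | mu in [set mu : R | 0 < mu /\ loewner rho (scaleO (cR mu) sigma)]].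

Definition Idown {A B : finType} (alpha : R) (rho : Op (A * B)%type) : \bar R :=
  ereal_inf [set x | exists sigma : Op B, dens_le sigma /\
                        x = Dsand alpha rho (tensO (ptr2 rho) sigma)].

Definition Idd_inf {A B : finType} (rho : Op (A * B)%type) : \bar R :=
  ereal_inf [set x | exists (om : Op A) (sigma : Op B), dens_le om /\ dens_le sigma /\
                        x = Dmax rho (tensO om sigma)].

Definition Imax_dd {A B : finType} (eps : R) (rho : Op (A * B)%type) : \bar R :=
  ereal_inf [set x | exists rt : Op (A * B)%type, dens_le rt /\ pdist rt rho <= eps /\
                        x = Idd_inf rt].

Definition chan_id {A B D : finType} (M : Op A -> Op B) (X : Op (A * D)%type)
  : Op (B * D)%type :=
  fun bd bd' => M (fun a a' => X (a, bd.2) (a', bd'.2)) bd.1 bd'.1.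

Definition channel {A B : finType} (M : Op A -> Op B) : Prop :=
  (forall (c : C) (X Y : Op A), M (addO (scaleO c X) Y) = addO (scaleO c (M X)) (M Y)) /\
  (forall (D : finType) (X : Op (A * D)%type), psd X -> psd (chan_id M X)) /\
  (forall X : Op A, trO (M X) = trO X).

(* the registers L_1 ... L_i, with L : nat -> finType (L k = L_k) *)
Fixpoint Lcat (L : nat -> finType) (i : nat) : finType :=
  match i with
  | 0 => unit
  | k.+1 => (Lcat L k * L k.+1)%type
  end.

Definition Jreg (L : nat -> finType) (S E : finType) (i : nat) : finType :=
  (Lcat L i * (S * E))%type.

(* Channels: M k = M_{k+1} : R_k -> R_{k+1} L_{k+1}.  One step of the
   sequence: from a state on R_k L_1^k S E to a state on R_{k+1} L_1^{k+1} S E. *)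
Definition step (Rg L : nat -> finType) (S E : finType) (k : nat)
  (Mk : Op (Rg k) -> Op (Rg k.+1 * L k.+1)%type)
  (X : Op (Rg k * Jreg L S E k)%type) : Op (Rg k.+1 * Jreg L S E k.+1)%type :=
  fun y y' =>
    chan_id Mk X ((y.1, y.2.1.2), (y.2.1.1, y.2.2)) ((y'.1, y'.2.1.2), (y'.2.1.1, y'.2.2)).

Local Unset Implicit Arguments.
Fixpoint seqstate (Rg L : nat -> finType) (S E : finType)
  (M : forall k, Op (Rg k) -> Op (Rg k.+1 * L k.+1)%type)
  (rho : Op (Rg 0 * (S * E))%type) (k : nat) : Op (Rg k * Jreg L S E k)%type :=
  match k as k0 return Op (Rg k0 * Jreg L S E k0)%type with
  | 0 => fun y y' => rho (y.1, y.2.2) (y'.1, y'.2.2)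
  | k1.+1 => @step Rg L S E k1 (M k1) (seqstate Rg L S E M rho k1)
  end.
Local Set Implicit Arguments.
Arguments seqstate [Rg L S E] M rho k.

Definition final_SE_L (Rg L : nat -> finType) (S E : finType)
  (M : forall k, Op (Rg k) -> Op (Rg k.+1 * L k.+1)%type)
  (rho : Op (Rg 0 * (S * E))%type) (n : nat) : Op ((S * E) * Lcat L n)%type :=
  swapO (ptr1 (seqstate M rho n)).

(* For the k-th channel (k = i-1): the state M_i(sigma) on L_1^{i-1} S E (x) L_i,
   with R_i traced out, for sigma on R_{i-1} L_1^{i-1} S E. *)
Definition out_JL (Rg L : nat -> finType) (S E : finType) (k : nat)
  (Mk : Op (Rg k) -> Op (Rg k.+1 * L k.+1)%type)
  (sigma : Op (Rg k * Jreg L S E k)%type) : Op (Jreg L S E k * L k.+1)%type :=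
  fun jl jl' => \sum_r chan_id Mk sigma ((r, jl.2), jl.1) ((r, jl'.2), jl'.1).

Definition chan_term (Rg L : nat -> finType) (S E : finType) (alpha : R) (k : nat)
  (Mk : Op (Rg k) -> Op (Rg k.+1 * L k.+1)%type) : \bar R :=
  ereal_sup [set x | exists sigma : Op (Rg k * Jreg L S E k)%type,
                        dens_eq sigma /\ x = Idown alpha (out_JL Mk sigma)].

Definition gE (eps : R) : \bar R :=
  if 1 - Num.sqrt (1 - eps ^+ 2) == 0 then -oo%E
  else (log2 (1 - Num.sqrt (1 - eps ^+ 2)))%:E.

End QInfo.

Arguments final_SE_L {R Rg L S E} M rho n.
Arguments chan_term {R Rg L} S E alpha {k} Mk.
Arguments seqstate {R Rg L S E} M rho k.

(* Main.v *)
(** The sandwiched quantity Q(rho||sg) = Tr (sg^-s rho sg^-s)^alpha, with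
    s = (alpha-1)/(2 alpha), obeys an exact chain rule when one channel acts
    on the memory register: for a suitable input state sigma that does not
    depend on tau,
      Q(M(rho)||w (x) tau) = Q(rho_J||w) * Q(M(sigma)||sigma_J (x) tau).
    Hence a near-optimal tau can be chosen greedily at each step, with no
    minimax argument.  This bounds D_alpha of the final state relative to a
    product state, and a smoothing argument based on the positive part of
    rho - lambda sg turns it into a bound on the smooth max-information. *)

From Pilot Require Import Defs.
From HB Require Import structures.
From mathcomp Require Import all_boot all_order all_algebra.
From mathcomp Require Import all_classical all_reals all_analysis.
From mathcomp Require Import complex.
From mathcomp Require Import ring lra.
(* The analysis library has lemmas named [addO] and [mulO], which would
   otherwise hide the operations on [Op]. *)
Import Pilot.Defs.
Import Order.TTheory GRing.Theory Num.Theory.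
Local Open Scope ring_scope.
Set Implicit Arguments.
Unset Strict Implicit.
Unset Printing Implicit Defensive.

(** * Operators and positivity *)

Section Algebra.
Variable R : realType.
Local Notation C := R[i].
Implicit Types T A B : finType.

(** The obstacle is a mismatch of reference operators: [Idown] compares a channel output with the
    marginal of that same output, while the chain carries a reference [w] built from earlier
    choices. The input sigma is designed so that its own marginal, raised to the negative
    sandwiching power, cancels the factors that define sigma; the two sandwiched operators then
    agree up to a scalar. The channel enters this cancellation only through linearity and the fact
    that operators on the side registers pass through it. Smoothing needs data processing for a
    single projective measurement, which follows from Young's and Jensen's inequalities. With lambda
    solving lambda^(1-alpha) Q = 1 - sqrt(1 - eps^2), the positive part has trace at most 1 - sqrt(1
    - eps^2). The fidelity drops by no more than this trace, so it stays at least sqrt(1 - eps^2),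
    which is purified distance at most eps. Taking log lambda produces the term
    -g(eps)/(alpha-1). *)

Definition oneO {T : finType} : Op R T := fun a b => (a == b)%:R.
Definition app {T : finType} (X : Op R T) (v : T -> C) : T -> C :=
  fun a => \sum_b X a b * v b.
Definition inner {T : finType} (u v : T -> C) : C := \sum_a conjc (u a) * v a.

Lemma eqO {T} (X Y : Op R T) : (forall a b, X a b = Y a b) -> X = Y.
Proof. by move=> h; apply/funext => a; apply/funext => b. Qed.

Lemma mulOA {T} (X Y Z : Op R T) : mulO X (mulO Y Z) = mulO (mulO X Y) Z.
Proof.
apply: eqO => a b; rewrite /mulO.
under eq_bigr do rewrite big_distrr /=.
rewrite exchange_big /=; apply: eq_bigr => c _.
by rewrite big_distrl /=; apply: eq_bigr => d _; rewrite mulrA.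
Qed.

Lemma mulODl {T} (X Y Z : Op R T) : mulO (addO X Y) Z = addO (mulO X Z) (mulO Y Z).
Proof. by apply: eqO => a b; rewrite /mulO /addO -big_split /=; apply: eq_bigr => c _; rewrite mulrDl. Qed.
Lemma mulOBl {T} (X Y Z : Op R T) : mulO (subO X Y) Z = subO (mulO X Z) (mulO Y Z).
Proof. by apply: eqO => a b; rewrite /mulO /subO -sumrB /=; apply: eq_bigr => c _; rewrite mulrBl. Qed.
Lemma mulOBr {T} (X Y Z : Op R T) : mulO Z (subO X Y) = subO (mulO Z X) (mulO Z Y).
Proof. by apply: eqO => a b; rewrite /mulO /subO -sumrB /=; apply: eq_bigr => c _; rewrite mulrBr. Qed.
Lemma mulOZl {T} c (X Y : Op R T) : mulO (scaleO c X) Y = scaleO c (mulO X Y).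
Proof. by apply: eqO => a b; rewrite /mulO /scaleO big_distrr /=; apply: eq_bigr => d _; rewrite mulrA. Qed.
Lemma mulOZr {T} c (X Y : Op R T) : mulO X (scaleO c Y) = scaleO c (mulO X Y).
Proof. by apply: eqO => a b; rewrite /mulO /scaleO big_distrr /=; apply: eq_bigr => d _; rewrite mulrCA. Qed.
Lemma scaleOA {T} c d (X : Op R T) : scaleO c (scaleO d X) = scaleO (c * d) X.
Proof. by apply: eqO => a b; rewrite /scaleO mulrA. Qed.
Lemma scale1O {T} (X : Op R T) : scaleO 1 X = X.
Proof. by apply: eqO => a b; rewrite /scaleO mul1r. Qed.

Lemma sum_delta_l {T} (F : T -> C) a : \sum_c (a == c)%:R * F c = F a.
Proof.
rewrite (bigD1 a) //= eqxx mul1r big1 ?addr0 // => c; rewrite eq_sym => /negbTE ->.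
by rewrite mul0r.
Qed.
Lemma sum_delta_r {T} (F : T -> C) a : \sum_c F c * (c == a)%:R = F a.
Proof. by rewrite -[RHS]sum_delta_l; apply: eq_bigr => c _; rewrite mulrC eq_sym. Qed.

Lemma mul1O {T} (X : Op R T) : mulO oneO X = X.
Proof. by apply: eqO => a b; rewrite /mulO /oneO sum_delta_l. Qed.
Lemma mulO1 {T} (X : Op R T) : mulO X oneO = X.
Proof. by apply: eqO => a b; rewrite /mulO /oneO sum_delta_r. Qed.

Lemma adjOM {T} (X Y : Op R T) : adjO (mulO X Y) = mulO (adjO Y) (adjO X).
Proof.
apply: eqO => a b; rewrite /adjO /mulO rmorph_sum /=.
by apply: eq_bigr => c _; rewrite rmorphM mulrC.
Qed.
Lemma adjOK {T} (X : Op R T) : adjO (adjO X) = X.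
Proof. by apply: eqO => a b; rewrite /adjO conjcK. Qed.
Lemma adjOB {T} (X Y : Op R T) : adjO (subO X Y) = subO (adjO X) (adjO Y).
Proof. by apply: eqO => a b; rewrite /adjO /subO rmorphB. Qed.
Lemma adjO1 {T} : adjO (@oneO T) = oneO.
Proof. by apply: eqO => a b; rewrite /adjO /oneO conjc_nat eq_sym. Qed.

Lemma trOD {T} (X Y : Op R T) : trO (addO X Y) = trO X + trO Y.
Proof. by rewrite /trO -big_split. Qed.
Lemma trOB {T} (X Y : Op R T) : trO (subO X Y) = trO X - trO Y.
Proof. by rewrite /trO -sumrB. Qed.
Lemma trOZ {T} c (X : Op R T) : trO (scaleO c X) = c * trO X.
Proof. by rewrite /trO big_distrr. Qed.
Lemma trOC {T} (X Y : Op R T) : trO (mulO X Y) = trO (mulO Y X).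
Proof.
rewrite /trO /mulO exchange_big /=.
by apply: eq_bigr => a _; apply: eq_bigr => b _; rewrite mulrC.
Qed.
Lemma trO_adj {T} (X : Op R T) : trO (adjO X) = conjc (trO X).
Proof. by rewrite /trO rmorph_sum. Qed.

Lemma app_mul {T} (X Y : Op R T) v : app (mulO X Y) v = app X (app Y v).
Proof.
apply/funext => a; rewrite /app /mulO.
under eq_bigr do rewrite big_distrl /=.
rewrite exchange_big /=; apply: eq_bigr => c _.
by rewrite big_distrr /=; apply: eq_bigr => d _; rewrite mulrA.
Qed.
Lemma app_add {T} (X Y : Op R T) v a : app (addO X Y) v a = app X v a + app Y v a.
Proof. by rewrite /app /addO -big_split /=; apply: eq_bigr => b _; rewrite mulrDl. Qed.
Lemma app_sub {T} (X Y : Op R T) v a : app (subO X Y) v a = app X v a - app Y v a.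
Proof. by rewrite /app /subO -sumrB /=; apply: eq_bigr => b _; rewrite mulrBl. Qed.
Lemma app_scale {T} c (X : Op R T) v a : app (scaleO c X) v a = c * app X v a.
Proof. by rewrite /app /scaleO big_distrr /=; apply: eq_bigr => b _; rewrite mulrA. Qed.
Lemma app_id {T} (v : T -> C) : app oneO v = v.
Proof. by apply/funext => a; rewrite /app sum_delta_l. Qed.
Lemma appDv {T} (X : Op R T) u v : app X (fun a => u a + v a) = (fun a => app X u a + app X v a).
Proof. by apply/funext => a; rewrite /app -big_split /=; apply: eq_bigr => b _; rewrite mulrDr. Qed.
Lemma appZv {T} (X : Op R T) c v : app X (fun a => c * v a) = (fun a => c * app X v a).
Proof. by apply/funext => a; rewrite /app big_distrr /=; apply: eq_bigr => b _; rewrite mulrCA. Qed.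

Lemma innerDl {T} (u u' v : T -> C) : inner (fun a => u a + u' a) v = inner u v + inner u' v.
Proof. by rewrite /inner -big_split /=; apply: eq_bigr => a _; rewrite rmorphD mulrDl. Qed.
Lemma innerDr {T} (u v v' : T -> C) : inner u (fun a => v a + v' a) = inner u v + inner u v'.
Proof. by rewrite /inner -big_split /=; apply: eq_bigr => a _; rewrite mulrDr. Qed.
Lemma innerBr {T} (u v v' : T -> C) : inner u (fun a => v a - v' a) = inner u v - inner u v'.
Proof. by rewrite /inner -sumrB /=; apply: eq_bigr => a _; rewrite mulrBr. Qed.
Lemma innerZl {T} c (u v : T -> C) : inner (fun a => c * u a) v = conjc c * inner u v.
Proof. by rewrite /inner big_distrr /=; apply: eq_bigr => a _; rewrite rmorphM mulrA. Qed.
Lemma innerZr {T} c (u v : T -> C) : inner u (fun a => c * v a) = c * inner u v.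
Proof. by rewrite /inner big_distrr /=; apply: eq_bigr => a _; rewrite mulrCA. Qed.
Lemma inner_conj {T} (u v : T -> C) : conjc (inner u v) = inner v u.
Proof.
by rewrite /inner rmorph_sum /=; apply: eq_bigr => a _; rewrite rmorphM /= conjcK mulrC.
Qed.
Lemma inner_adj {T} (X : Op R T) u v : inner u (app X v) = inner (app (adjO X) u) v.
Proof.
rewrite /inner /app; under eq_bigr do rewrite big_distrr /=.
rewrite exchange_big /=; apply: eq_bigr => b _.
rewrite rmorph_sum big_distrl /=; apply: eq_bigr => a _.
by rewrite rmorphM /= conjcK mulrA [conjc _ * _]mulrC.
Qed.
Lemma inner_ge0 {T} (u : T -> C) : 0 <= inner u u.
Proof. by apply: sumr_ge0 => a _; rewrite mulrC mulcJ_ge0. Qed.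
Lemma inner_eq0 {T} (u : T -> C) : inner u u = 0 -> forall a, u a = 0.
Proof.
move=> h a; have := h; rewrite /inner => /psumr_eq0P h'.
have /h' : forall i : T, true -> 0 <= conjc (u i) * u i by move=> i _; rewrite mulrC mulcJ_ge0.
by move=> /(_ a isT)/eqP; rewrite mulf_eq0 conjc_eq0 orbb => /eqP.
Qed.

Definition basisv {T : finType} (a : T) : T -> C := fun b => (b == a)%:R.
Lemma app_basis {T} (X : Op R T) a b : app X (basisv a) b = X b a.
Proof. by rewrite /app sum_delta_r. Qed.
Lemma inner_basis {T} (v : T -> C) a : inner (basisv a) v = v a.
Proof.
rewrite /inner -[RHS]sum_delta_l; apply: eq_bigr => b _.
by rewrite /basisv conjc_nat eq_sym.
Qed.

Lemma psdP {T} (X : Op R T) : psd X <-> forall v, 0 <= inner v (app X v).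
Proof.
suff h v : \sum_a \sum_b conjc (v a) * X a b * v b = inner v (app X v).
  by split=> H v; have := H v; rewrite h.
apply: eq_bigr => a _; rewrite /app big_distrr /=.
by apply: eq_bigr => b _; rewrite mulrA.
Qed.

Lemma psd_conj {T} (K X : Op R T) : psd X -> psd (mulO (mulO K X) (adjO K)).
Proof.
move=> /psdP h; apply/psdP => v.
by rewrite !app_mul inner_adj.
Qed.
Lemma psd_add {T} (X Y : Op R T) : psd X -> psd Y -> psd (addO X Y).
Proof.
move=> /psdP hX /psdP hY; apply/psdP => v.
have -> : app (addO X Y) v = (fun a => app X v a + app Y v a).
  by apply/funext => a; rewrite app_add.
by rewrite innerDr addr_ge0.
Qed.
Lemma psd_scale {T} (c : C) (X : Op R T) : 0 <= c -> psd X -> psd (scaleO c X).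
Proof.
move=> hc /psdP hX; apply/psdP => v.
have -> : app (scaleO c X) v = (fun a => c * app X v a).
  by apply/funext => a; rewrite app_scale.
by rewrite innerZr mulr_ge0.
Qed.
Lemma psd_id {T} : psd (@oneO T).
Proof. by apply/psdP => v; rewrite app_id inner_ge0. Qed.
Lemma psd_gram {T} (K : Op R T) : psd (mulO K (adjO K)).
Proof. by rewrite -[X in mulO X _](mulO1 K); apply: psd_conj; apply: psd_id. Qed.
Lemma psd_diag {T} (X : Op R T) a : psd X -> 0 <= X a a.
Proof. by move=> /psdP /(_ (basisv a)); rewrite inner_basis app_basis. Qed.
Lemma psd_tr {T} (X : Op R T) : psd X -> 0 <= trO X.
Proof. by move=> h; apply: sumr_ge0 => a _; apply: psd_diag. Qed.

(** Polarization: the order on complex numbers forces the quadratic form to be real, and its values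
    at e_a + e_b and e_a + i e_b fix the imaginary and real parts of the off-diagonal entries. *)
Lemma psd_herm {T} (X : Op R T) : psd X -> adjO X = X.
Proof.
move=> /psdP hX; apply: eqO => a b; rewrite /adjO.
have E c : inner (fun x => basisv a x + c * basisv b x)
   (app X (fun x => basisv a x + c * basisv b x)) =
   X a a + c * X a b + conjc c * X b a + conjc c * c * X b b.
  rewrite appDv appZv /= innerDl innerZl.
  have D u : inner u (fun x => app X (basisv a) x + c * app X (basisv b) x) =
      inner u (app X (basisv a)) + c * inner u (app X (basisv b)).
    by rewrite (innerDr u (app X (basisv a)) (fun x => c * app X (basisv b) x)) innerZr.
  by rewrite !D !inner_basis !app_basis mulrDr addrA !mulrA.
have h1 := hX (fun x => basisv a x + 1 * basisv b x).
have h2 := hX (fun x => basisv a x + 'i%C * basisv b x).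
have ha := hX (basisv a); have hb := hX (basisv b).
rewrite !inner_basis !app_basis in ha hb.
move: h1 h2 ha hb; rewrite !E.
case: (X a a) => x1 y1; case: (X b b) => x2 y2; case: (X a b) => x3 y3; case: (X b a) => x4 y4.
simpc.
move=> /andP[/eqP e1 _] /andP[/eqP e2 _] /andP[/eqP e3 _] /andP[/eqP e4 _].
subst y1 y2; congr Complex.
  by move: e2; rewrite !add0r !addr0 => /eqP; rewrite subr_eq0 => /eqP.
by move: e1; rewrite !add0r !addr0 => /eqP; rewrite addr_eq0 => /eqP ->.
Qed.

Lemma gram_eq0 {T} (K : Op R T) : trO (mulO K (adjO K)) = 0 -> forall a b, K a b = 0.
Proof.
move=> h a b.
have h1 c : mulO K (adjO K) c c = inner (fun d => conjc (K c d)) (fun d => conjc (K c d)).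
  by rewrite /mulO /adjO /inner; apply: eq_bigr => d _; rewrite conjcK.
have : mulO K (adjO K) a a = 0.
  by have /psumr_eq0P := h; apply => // i _; apply: psd_diag; apply: psd_gram.
by rewrite h1 => /inner_eq0 /(_ b) /eqP; rewrite conjc_eq0 => /eqP.
Qed.

End Algebra.
Arguments oneO {R T}.
Arguments basisv {R T} a.

(** * Spectral theorem *)

Section Spectral.
Variable R : realType.
Local Notation C := R[i].
Implicit Types T A B : finType.

Lemma spectral_theorem {T} (X : Op R T) : adjO X = X -> exists p, specdec X p.
Proof.
move=> hX; pose n := #|T|.
pose H : 'M[C]_n := \matrix_(i, j) X (enum_val i) (enum_val j).
have Hh : H \is hermsymmx.
  rewrite is_hermitianmxE expr0 scale1r; apply/eqP/matrixP => i j.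
  by rewrite !mxE -{1}hX.
have /orthomx_spectralP := hermitian_normalmx Hh.
have PU := spectral_unitarymx H.
rewrite invmx_unitary //.
set P := spectralmx H in PU *; set sp := spectral_diag H => HE.
have spR := hermitian_spectral_diag_real Hh.
(* Here H = P^* diag(sp) P, so the eigenvectors are the conjugated rows of [P]. The entries of [sp]
   are real, hence [Re] loses nothing. *)
exists (fun a k => conjc (P (enum_rank k) (enum_rank a)),
        fun k => complex.Re (sp 0 (enum_rank k))); split => /=.
  move=> k l; have /unitarymxP /matrixP /(_ (enum_rank k) (enum_rank l)) := PU.
  rewrite !mxE (inj_eq enum_rank_inj) => <-.
  rewrite (reindex_onto enum_val enum_rank) => [|i _]; last exact: enum_rankK.
  apply: eq_big => [i|i _]; first by rewrite enum_valK eqxx.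
  by rewrite !mxE enum_valK conjcK.
apply: eqO => a b.
have -> : X a b = H (enum_rank a) (enum_rank b) by rewrite mxE !enum_rankK.
rewrite {1}HE !mxE (reindex_onto enum_rank enum_val) => [|i _]; last exact: enum_valK.
apply: eq_big => [i|i _]; first by rewrite enum_rankK eqxx.
rewrite conjcK mul_mx_diag !mxE /cR complexr0.
have /mxOverP/(_ 0 (enum_rank i)) /RRe_real -> := spR.
by rewrite [sp _ _ * _]mulrC.
Qed.

Definition specfun {T} (f : R -> R) (p : Op R T * (T -> R)) : Op R T :=
  fun a b => \sum_k cR (f (p.2 k)) * p.1 a k * conjc (p.1 b k).

Lemma fcalcE {T} (X : Op R T) f : adjO X = X ->
  exists2 p, specdec X p & fcalc f X = specfun f p.
Proof.
move=> /spectral_theorem h; rewrite /fcalc; case: pselect => // e.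
by exists (projT1 (cid e)) => //; case: cid.
Qed.

Definition eigv {T} (p : Op R T * (T -> R)) (k : T) : T -> C := fun a => p.1 a k.

Lemma cRD (x y : R) : cR (x + y) = cR x + cR y.
Proof. by rewrite /cR !complexr0 rmorphD. Qed.
Lemma cRM (x y : R) : cR (x * y) = cR x * cR y.
Proof. by rewrite /cR !complexr0 rmorphM. Qed.
Lemma conjM (x y : C) : conjc (x * y) = conjc x * conjc y.
Proof. exact: rmorphM. Qed.
Lemma conj_sum {T} (F : T -> C) : conjc (\sum_a F a) = \sum_a conjc (F a).
Proof. exact: rmorph_sum. Qed.
Lemma conj_cR (x : R) : conjc (cR x) = cR x.
Proof. by rewrite /cR complexr0 conjc_real. Qed.
Lemma cR_ge0 (x : R) : (0 <= cR x) = (0 <= x).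
Proof. by rewrite /cR complexr0 ler0c. Qed.

Lemma app_specfun {T} f p (v : T -> C) :
  app (specfun f p) v = fun a => \sum_k (cR (f (p.2 k)) * inner (eigv p k) v) * p.1 a k.
Proof.
apply/funext => a; rewrite /app /specfun; under eq_bigr do rewrite big_distrl /=.
rewrite exchange_big /=; apply: eq_bigr => k _.
rewrite /inner big_distrr big_distrl /=; apply: eq_bigr => b _.
by rewrite /eigv -!mulrA; congr (_ * _); rewrite mulrC -mulrA mulrC.
Qed.

Lemma specdec_orth {T} (X : Op R T) p k l : specdec X p ->
  inner (eigv p k) (eigv p l) = (k == l)%:R.
Proof. by case=> h _; exact: h. Qed.

Lemma specfun_eig {T} (X : Op R T) p f k : specdec X p ->
  app (specfun f p) (eigv p k) = fun a => cR (f (p.2 k)) * eigv p k a.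
Proof.
move=> hp; rewrite app_specfun; apply/funext => a.
rewrite -(sum_delta_r (fun k => cR (f (p.2 k)) * eigv p k a)).
apply: eq_bigr => l _; rewrite (specdec_orth _ _ hp) -!mulrA; congr (_ * _).
by rewrite mulrC.
Qed.

Lemma specdec_eig {T} (X : Op R T) p k : specdec X p ->
  app X (eigv p k) = fun a => cR (p.2 k) * eigv p k a.
Proof.
move=> hp; rewrite -(specfun_eig id k hp); congr app; by case: hp => _ ->.
Qed.

(** Orthonormality reads V U = 1 for square matrices, and a left inverse is also a right inverse. *)
Lemma specdec_complete {T} (X : Op R T) p a b : specdec X p ->
  \sum_k p.1 a k * conjc (p.1 b k) = (a == b)%:R.
Proof.
case=> h _; pose n := #|T|.
pose U : 'M[C]_n := \matrix_(i, j) p.1 (enum_val i) (enum_val j).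
pose V : 'M[C]_n := \matrix_(i, j) conjc (p.1 (enum_val j) (enum_val i)).
have VU : V *m U = 1%:M.
  apply/matrixP => i j; rewrite !mxE -(inj_eq enum_val_inj) -h; symmetry.
  rewrite (reindex_onto enum_val enum_rank) => [|k _]; last exact: enum_rankK.
  apply: eq_big => [k|k _]; first by rewrite enum_valK eqxx.
  by rewrite !mxE.
have /matrixP/(_ (enum_rank a) (enum_rank b)) := mulmx1C VU.
rewrite !mxE (inj_eq enum_rank_inj) => <-.
rewrite (reindex_onto enum_val enum_rank) => [|k _]; last exact: enum_rankK.
apply: eq_big => [k|k _]; first by rewrite enum_valK eqxx.
by rewrite !mxE !enum_rankK.
Qed.

Lemma specfun1 {T} (X : Op R T) p : specdec X p -> specfun (fun=> 1) p = oneO.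
Proof.
move=> hp; apply: eqO => a b; rewrite /specfun /oneO -(specdec_complete a b hp).
by apply: eq_bigr => k _; rewrite {1}/cR complexr0 mul1r.
Qed.

Lemma vec_expand {T} (X : Op R T) p (v : T -> C) : specdec X p ->
  v = fun a => \sum_k inner (eigv p k) v * p.1 a k.
Proof.
move=> hp; rewrite -{1}[v]app_id -(specfun1 hp) app_specfun.
by apply/funext => a; apply: eq_bigr => k _; rewrite {1}/cR complexr0 mul1r.
Qed.

Lemma app_eig_ext {T} (X Y Z : Op R T) p : specdec X p ->
  (forall k, app Y (eigv p k) = app Z (eigv p k)) -> Y = Z.
Proof.
move=> hp h; apply: eqO => a b; rewrite -!app_basis.
rewrite (vec_expand (basisv b) hp).
have E W : app W (fun a => \sum_k inner (eigv p k) (basisv b) * p.1 a k) a =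
   \sum_k inner (eigv p k) (basisv b) * app W (eigv p k) a.
  rewrite /app; under eq_bigr do rewrite big_distrr /=.
  rewrite exchange_big /=; apply: eq_bigr => k _; rewrite big_distrr /=.
  by apply: eq_bigr => c _; rewrite mulrCA.
by rewrite !E; apply: eq_bigr => k _; rewrite h.
Qed.

(* If X K = K Y then f(X) K = K f(Y): compare matrix elements between
   eigenvectors of X and of Y. *)
Lemma specfun_intertwine {T} (X Y K : Op R T) p q f : specdec X p -> specdec Y q ->
  mulO X K = mulO K Y -> mulO (specfun f p) K = mulO K (specfun f q).
Proof.
move=> hp hq hK; apply: (app_eig_ext hq) => l.
rewrite (app_mul (specfun f p) K) (app_mul K (specfun f q)).
rewrite (specfun_eig _ _ hq) appZv app_specfun.
apply/funext => a; rewrite {2}(vec_expand (app K (eigv q l)) hp) big_distrr /=.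
apply: eq_bigr => k _; rewrite !mulrA; congr (_ * _).
have hX : inner (eigv p k) (app X (app K (eigv q l))) =
    cR (p.2 k) * inner (eigv p k) (app K (eigv q l)).
  case: (hp) => _ XE.
  have Xh : adjO X = X.
    apply: eqO => x y; rewrite /adjO XE conj_sum; apply: eq_bigr => j _.
    by rewrite !conjM conj_cR conjcK -!mulrA; congr (_ * _); rewrite mulrC.
  by rewrite inner_adj Xh (specdec_eig _ hp) innerZl conj_cR.
move: hX; rewrite -app_mul hK app_mul (specdec_eig _ hq) appZv innerZr => /eqP.
rewrite -subr_eq0 -mulrBl mulf_eq0 => /orP[|/eqP ->]; last by rewrite !mulr0.
by rewrite subr_eq0 /cR => /eqP [->].
Qed.

(** The case K = 1 of the intertwining lemma: two decompositions of one operator give the same f(X),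
    so any convenient one may replace the one chosen inside [fcalc]. *)
Lemma fcalc_spec {T} (X : Op R T) p f : specdec X p -> fcalc f X = specfun f p.
Proof.
move=> hp; rewrite /fcalc; case: pselect => [e|]; last by case; exists p.
case: cid => q hq /=.
have h : mulO X oneO = mulO oneO X by rewrite mulO1 mul1O.
by have := specfun_intertwine f hq hp h; rewrite mulO1 mul1O.
Qed.

End Spectral.

(** * Functional calculus and powers *)

Section Calculus.
Variable R : realType.
Local Notation C := R[i].
Implicit Types T A B : finType.

Lemma specfun_adj {T} (p : Op R T * (T -> R)) f : adjO (specfun f p) = specfun f p.
Proof.
apply: eqO => x y; rewrite /adjO conj_sum; apply: eq_bigr => j _.
by rewrite !conjM conj_cR conjcK -!mulrA; congr (_ * _); rewrite mulrC.
Qed.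

Lemma fcalc_adj {T} (X : Op R T) f : adjO X = X -> adjO (fcalc f X) = fcalc f X.
Proof. by move=> /(fcalcE f) [p _ ->]; apply: specfun_adj. Qed.

Lemma fcalc_intertwine {T} (X Y K : Op R T) f : adjO X = X -> adjO Y = Y ->
  mulO X K = mulO K Y -> mulO (fcalc f X) K = mulO K (fcalc f Y).
Proof.
move=> /(fcalcE f) [p hp ->] /(fcalcE f) [q hq ->]; exact: specfun_intertwine.
Qed.

Lemma specfunM {T} (X : Op R T) p f g : specdec X p ->
  mulO (specfun f p) (specfun g p) = specfun (fun x => f x * g x) p.
Proof.
move=> hp; apply: (app_eig_ext hp) => k.
rewrite (app_mul (specfun f p) (specfun g p)) !(specfun_eig _ _ hp) appZv (specfun_eig _ _ hp).
by apply/funext => a; rewrite cRM mulrCA mulrA.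
Qed.

Lemma specdec_specfun {T} (X : Op R T) p f : specdec X p ->
  specdec (specfun f p) (p.1, fun k => f (p.2 k)).
Proof. by case=> h _; split. Qed.

Lemma fcalcM {T} (X : Op R T) f g : adjO X = X ->
  mulO (fcalc f X) (fcalc g X) = fcalc (fun x => f x * g x) X.
Proof.
move=> /spectral_theorem [p hp]; rewrite !(fcalc_spec _ hp); exact: specfunM hp.
Qed.

Lemma fcalc_comp {T} (X : Op R T) f g : adjO X = X ->
  fcalc g (fcalc f X) = fcalc (fun x => g (f x)) X.
Proof.
move=> /spectral_theorem [p hp]; rewrite !(fcalc_spec f hp).
by rewrite (fcalc_spec _ (specdec_specfun f hp)) (fcalc_spec _ hp).
Qed.

Lemma tr_specfun {T} (X : Op R T) p f : specdec X p ->
  trO (specfun f p) = \sum_k cR (f (p.2 k)).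
Proof.
move=> hp; rewrite /trO /specfun exchange_big /=; apply: eq_bigr => k _.
have h : \sum_a conjc (eigv p k a) * eigv p k a = 1.
  by have := specdec_orth k k hp; rewrite eqxx.
rewrite -[RHS]mulr1 -h big_distrr /=; apply: eq_bigr => a _.
by rewrite -mulrA; congr (_ * _); rewrite mulrC.
Qed.

Lemma inner_specfun {T} f (p : Op R T * (T -> R)) v :
  inner v (app (specfun f p) v) =
  \sum_k cR (f (p.2 k)) * (inner (eigv p k) v * conjc (inner (eigv p k) v)).
Proof.
rewrite app_specfun {1}/inner; under eq_bigr do rewrite big_distrr /=.
rewrite exchange_big /=; apply: eq_bigr => k _; rewrite inner_conj.
move: (inner (eigv p k) v) => z; rewrite /inner !big_distrr /=.
by apply: eq_bigr => a _; rewrite /eigv; ring.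
Qed.

Lemma specfun_psd {T} f (p : Op R T * (T -> R)) :
  (forall k, 0 <= f (p.2 k)) -> psd (specfun f p).
Proof.
move=> hf; apply/psdP => v; rewrite inner_specfun; apply: sumr_ge0 => k _.
by rewrite mulr_ge0 ?cR_ge0 ?mulcJ_ge0.
Qed.

Lemma fcalc_psd {T} (X : Op R T) f : adjO X = X -> (forall x, 0 <= f x) -> psd (fcalc f X).
Proof. by move=> /(fcalcE f) [p _ ->] hf; apply: specfun_psd. Qed.

Lemma psd_spec_ge0 {T} (X : Op R T) p k : psd X -> specdec X p -> 0 <= p.2 k.
Proof.
move=> /psdP h hp; have := h (eigv p k).
by rewrite (specdec_eig _ hp) innerZr (specdec_orth _ _ hp) eqxx mulr1 cR_ge0.
Qed.

Lemma fcalc_ext {T} (X : Op R T) f g : psd X -> (forall x, 0 <= x -> f x = g x) ->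
  fcalc f X = fcalc g X.
Proof.
move=> hX h; have [p hp] := spectral_theorem (psd_herm hX).
rewrite !(fcalc_spec _ hp); apply: eqO => a b; apply: eq_bigr => k _.
by rewrite h // (psd_spec_ge0 _ hX hp).
Qed.

Lemma fcalc_id {T} (X : Op R T) : adjO X = X -> fcalc id X = X.
Proof. by move=> /(fcalcE id) [p [_ E] ->]; rewrite [RHS]E. Qed.

Lemma fcalc_linear {T} (X : Op R T) f c : adjO X = X ->
  scaleO (cR c) (fcalc f X) = fcalc (fun x => c * f x) X.
Proof.
move=> /spectral_theorem [p hp]; rewrite !(fcalc_spec _ hp); apply: eqO => a b.
by rewrite /scaleO big_distrr /=; apply: eq_bigr => k _; rewrite cRM !mulrA.
Qed.

Lemma fcalcB {T} (X : Op R T) f g : adjO X = X ->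
  subO (fcalc f X) (fcalc g X) = fcalc (fun x => f x - g x) X.
Proof.
move=> /spectral_theorem [p hp]; rewrite !(fcalc_spec _ hp); apply: eqO => a b.
rewrite /subO -sumrB; apply: eq_bigr => k _; rewrite -!mulrBl.
by rewrite /cR !complexr0 rmorphB.
Qed.

Lemma fcalc_scale {T} (X : Op R T) f c : adjO X = X ->
  fcalc f (scaleO (cR c) X) = fcalc (fun x => f (c * x)) X.
Proof.
by move=> h; rewrite -{1}(fcalc_id h) fcalc_linear // fcalc_comp.
Qed.

Lemma specdec_tens {A B} (X : Op R A) (Y : Op R B) p q : specdec X p -> specdec Y q ->
  specdec (tensO X Y) (tensO p.1 q.1, fun k => p.2 k.1 * q.2 k.2).
Proof.
case=> hp hX [hq hY]; split => /=.
  move=> [k1 k2] [l1 l2]; rewrite /tensO /= -(pair_bigA _ (fun a b =>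
     conjc (p.1 a k1 * q.1 b k2) * (p.1 a l1 * q.1 b l2))) /=.
  rewrite xpair_eqE -mulnb natrM -hp -hq big_distrl /=; apply: eq_bigr => a _.
  rewrite big_distrr /=; apply: eq_bigr => b _.
  by rewrite conjM mulrACA.
apply: eqO => -[a b] [a' b']; rewrite /tensO /= -(pair_bigA _ (fun k l =>
  cR (p.2 k * q.2 l) * (p.1 a k * q.1 b l) * conjc (p.1 a' k * q.1 b' l))) /=.
rewrite hX hY big_distrl /=; apply: eq_bigr => k _.
rewrite big_distrr /=; apply: eq_bigr => l _.
by rewrite conjM cRM; ring.
Qed.

(** The function inside [mpow]. Sending every x <= 0 to 0 for all t makes exponents add without side
    conditions, so negative powers act as inverses on the support and the power 0 as its
    projector. *)
Definition powf (t x : R) : R := if 0 < x then x `^ t else 0.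

Lemma powf_ge0 t x : 0 <= powf t x.
Proof. by rewrite /powf; case: ifP => // _; apply: powR_ge0. Qed.
Lemma powfD s t x : powf s x * powf t x = powf (s + t) x.
Proof.
rewrite /powf; case: ifP => h; last by rewrite mulr0.
by rewrite powRD // (gt_eqF h) implybT.
Qed.
Lemma powf_comp s t x : powf t (powf s x) = powf (s * t) x.
Proof.
rewrite /powf; case: (ltP 0 x) => h; last by rewrite ltxx.
by rewrite powR_gt0 // powRrM.
Qed.
Lemma powfM t x y : 0 <= x -> 0 <= y -> powf t (x * y) = powf t x * powf t y.
Proof.
rewrite /powf le_eqVlt => /predU1P[<-|hx]; first by rewrite mul0r ltxx mul0r.
rewrite le_eqVlt => /predU1P[<-|hy]; first by rewrite mulr0 ltxx mulr0.
by rewrite mulr_gt0 // hx hy powRM // ltW.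
Qed.
Lemma powf1 x : 0 <= x -> powf 1 x = x.
Proof. by rewrite /powf le_eqVlt => /predU1P[<-|h]; rewrite ?ltxx // h powRr1 // ltW. Qed.

Lemma mpowE {T} (X : Op R T) t : mpow X t = fcalc (powf t) X.
Proof. by []. Qed.
Lemma mpow_psd {T} (X : Op R T) t : psd X -> psd (mpow X t).
Proof. by move=> /psd_herm h; apply: fcalc_psd => // x; apply: powf_ge0. Qed.
Lemma mpow_adj {T} (X : Op R T) t : psd X -> adjO (mpow X t) = mpow X t.
Proof. by move=> h; apply/psd_herm/mpow_psd. Qed.
Lemma mpowD {T} (X : Op R T) s t : psd X -> mulO (mpow X s) (mpow X t) = mpow X (s + t).
Proof.
move=> h; rewrite !mpowE fcalcM; last exact: psd_herm.
by apply: fcalc_ext => // x _; apply: powfD.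
Qed.
Lemma mpow1 {T} (X : Op R T) : psd X -> mpow X 1 = X.
Proof.
move=> h; rewrite -[RHS](fcalc_id (psd_herm h)); apply: fcalc_ext => // x; exact: powf1.
Qed.
Lemma mpow_comp {T} (X : Op R T) s t : psd X -> mpow (mpow X s) t = mpow X (s * t).
Proof.
move=> h; rewrite !mpowE fcalc_comp; last exact: psd_herm.
by apply: fcalc_ext => // x _; apply: powf_comp.
Qed.
Lemma mpow_scale {T} (X : Op R T) c t : 0 <= c -> psd X ->
  mpow (scaleO (cR c) X) t = scaleO (cR (powf t c)) (mpow X t).
Proof.
move=> hc h; have hh := psd_herm h.
rewrite !mpowE fcalc_scale // fcalc_linear //; apply: fcalc_ext => // x hx; exact: powfM.
Qed.
Lemma msqrtE {T} (X : Op R T) : psd X -> msqrt X = mpow X 2^-1.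
Proof.
move=> h; rewrite mpowE; apply: fcalc_ext => // x; rewrite le_eqVlt => /predU1P[<-|hx].
  by rewrite /powf ltxx sqrtr0.
by rewrite /powf hx powR12_sqrt // ltW.
Qed.

Lemma mpow_tens {A B} (X : Op R A) (Y : Op R B) t : psd X -> psd Y ->
  mpow (tensO X Y) t = tensO (mpow X t) (mpow Y t).
Proof.
move=> hX hY; have [p hp] := spectral_theorem (psd_herm hX).
have [q hq] := spectral_theorem (psd_herm hY).
rewrite !mpowE (fcalc_spec _ hp) (fcalc_spec _ hq) (fcalc_spec _ (specdec_tens hp hq)).
have [_ ->] := specdec_tens (specdec_specfun (powf t) hp) (specdec_specfun (powf t) hq).
apply: eqO => a b; apply: eq_bigr => -[k l] _ /=.
by rewrite powfM // (psd_spec_ge0 _ hX hp, psd_spec_ge0 _ hY hq).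
Qed.

Lemma psd_tens {A B} (X : Op R A) (Y : Op R B) : psd X -> psd Y -> psd (tensO X Y).
Proof.
move=> hX hY; have [p hp] := spectral_theorem (psd_herm hX).
have [q hq] := spectral_theorem (psd_herm hY).
have [_ ->] := specdec_tens hp hq; apply: (specfun_psd (f := id)) => -[k l] /=.
by rewrite mulr_ge0 // (psd_spec_ge0 _ hX hp, psd_spec_ge0 _ hY hq).
Qed.

(* [mpow X 0] is the projector onto the support of X. *)
Lemma suppM {T} (X : Op R T) : psd X -> mulO (mpow X 0) X = X.
Proof. by move=> h; rewrite -{2}(mpow1 h) mpowD // add0r mpow1. Qed.

Lemma supp_subP {T} (X Y : Op R T) : psd Y -> supp_sub X Y <-> mulO (mpow Y 0) X = X.
Proof.
move=> hY; split => [h|h v].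
  apply: eqO => a b; rewrite -!app_basis app_mul.
  have [w hw] := h (basisv b).
  have -> : app X (basisv b) = app Y w by apply/funext => c; exact: hw.
  by rewrite -app_mul suppM.
(* The generalized inverse of [Y] supplies a preimage of X v. *)
exists (app (mulO (mpow Y (-1)) X) v) => a.
change (app X v a = app Y (app (mulO (mpow Y (-1)) X) v) a).
have E : mulO Y (mpow Y (-1)) = mpow Y 0 by rewrite -{1}(mpow1 hY) mpowD // subrr.
by rewrite -app_mul mulOA E h.
Qed.

End Calculus.

(** * Trace inequalities *)

Section TraceIneq.
Variable R : realType.
Local Notation C := R[i].
Local Notation Re := (@complex.Re R).
Implicit Types T A B : finType.

Lemma ReD (x y : C) : Re (x + y) = Re x + Re y.
Proof. by case: x; case: y. Qed.
Lemma ReN (x : C) : Re (- x) = - Re x.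
Proof. by case: x. Qed.
Lemma Re_sum {T} (F : T -> C) : Re (\sum_a F a) = \sum_a Re (F a).
Proof. by apply: (big_morph _ ReD). Qed.
Lemma Re_cR (x : R) : Re (cR x) = x.
Proof. by []. Qed.
Lemma Re_cRM (x : R) (z : C) : Re (cR x * z) = x * Re z.
Proof. by case: z => a b; rewrite /cR /=; simpc. Qed.
Lemma Re_ge0 (z : C) : 0 <= z -> 0 <= Re z.
Proof. by rewrite lecE => /andP[]. Qed.
Lemma Re_le (z w : C) : z <= w -> Re z <= Re w.
Proof. by rewrite lecE => /andP[]. Qed.
Lemma ReK (z : C) : 0 <= z -> cR (Re z) = z.
Proof. by case: z => a b; rewrite lecE /= => /andP[/eqP -> _]. Qed.
Lemma Re_conj (z : C) : Re (conjc z) = Re z.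
Proof. by case: z. Qed.

Lemma mpow_half {T} (X : Op R T) : psd X -> mulO (mpow X 2^-1) (mpow X 2^-1) = X.
Proof.
move=> h; rewrite mpowD // -{2}(mpow1 h); congr mpow; lra.
Qed.

Lemma tr_mul_ge0 {T} (X Y : Op R T) : psd X -> psd Y -> 0 <= trO (mulO X Y).
Proof.
move=> hX hY; rewrite -(mpow_half hX) -mulOA trOC.
by rewrite -{2}(mpow_adj 2^-1 hX); apply/psd_tr/psd_conj.
Qed.

(** The trace of Q X is the squared Hilbert-Schmidt norm of Q X^(1/2), so already Q X^(1/2) = 0. *)
Lemma mulO_eq0 {T} (X Q : Op R T) : psd X -> adjO Q = Q -> mulO Q Q = Q ->
  trO (mulO Q X) = 0 -> mulO Q X = fun _ _ => 0.
Proof.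
move=> hX hQ hQQ h; set S := mpow X 2^-1.
have hS : mulO S S = X := mpow_half hX.
have h0 : trO (mulO (mulO Q S) (adjO (mulO Q S))) = 0.
  have hSa : adjO S = S := mpow_adj _ hX.
  by rewrite adjOM hQ hSa mulOA -(mulOA Q S S) hS trOC mulOA hQQ.
apply: eqO => a b; rewrite -hS mulOA /mulO big1 // => c _.
by rewrite -/(mulO Q S a c) (gram_eq0 h0) mul0r.
Qed.

(** Young's inequality x m^(r-1) <= x^r / r + m^r / r' at the mean m, averaged over the weights,
    gives m^r <= s / r + m^r / r' with s the right-hand side; then m^r / r' is subtracted. *)
Lemma powR_jensen {T} (w x : T -> R) (r : R) : 1 < r ->
  (forall k, 0 <= w k) -> (forall k, 0 <= x k) -> \sum_k w k = 1 ->
  (\sum_k w k * x k) `^ r <= \sum_k w k * x k `^ r.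
Proof.
move=> hr hw hx w1; set m := \sum_k w k * x k.
have r0 : 0 < r by lra.
have m0 : 0 <= m by apply: sumr_ge0 => k _; rewrite mulr_ge0.
pose r' := r / (r - 1).
have r'0 : 0 < r' by rewrite divr_gt0 //; lra.
have rr' : r^-1 + r'^-1 = 1 by rewrite /r'; field; apply/andP; split; lra.
have rm : (r - 1) * r' = r by rewrite /r'; field; lra.
have Y k : x k * m `^ (r - 1) <= x k `^ r / r + m `^ r / r'.
  have := conjugate_powR (hx k) (powR_ge0 m (r - 1)) r0 r'0 rr'.
  by rewrite -powRrM rm.
have mm : m `^ r = m * m `^ (r - 1).
  rewrite -{2}[m](powRr1 m0) -powRD; first by congr powR; lra.
  by rewrite gt_eqF // addrC subrK.
have : \sum_k w k * (x k * m `^ (r - 1)) <= \sum_k w k * (x k `^ r / r + m `^ r / r').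
  by apply: ler_sum => k _; rewrite ler_wpM2l.
under eq_bigr do rewrite mulrA.
rewrite -big_distrl /= -/m -mm.
under eq_bigr do rewrite mulrDr.
rewrite big_split /= -[X in _ + X]big_distrl /= w1 mul1r.
under eq_bigr do rewrite mulrA.
rewrite -big_distrl /= => h.
set s := \sum_k _ in h *.
have : m `^ r / r <= s / r by move: rr' => /(congr1 (fun z => m `^ r * z)); lra.
by rewrite ler_pM2r // invr_gt0.
Qed.

(** The weights |<e_k, v>|^2 in an eigenbasis of X form a probability distribution, so the scalar
    Jensen inequality applies to the spectrum. *)
Lemma inner_jensen {T} (X : Op R T) v r : psd X -> inner v v = 1 -> 1 < r ->
  Re (inner v (app X v)) `^ r <= Re (inner v (app (mpow X r) v)).
Proof.
move=> hX v1 hr; have [p hp] := spectral_theorem (psd_herm hX).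
have hl k := psd_spec_ge0 k hX hp.
have r0 : 0 < r by lra.
rewrite mpowE (fcalc_spec _ hp) -{1}(fcalc_id (psd_herm hX)) (fcalc_spec _ hp).
pose w k := Re (inner (eigv p k) v * conjc (inner (eigv p k) v)).
have E f : Re (inner v (app (specfun f p) v)) = \sum_k w k * f (p.2 k).
  by rewrite inner_specfun Re_sum; apply: eq_bigr => k _; rewrite Re_cRM mulrC.
rewrite !E; apply: le_trans (_ : _ <= \sum_k w k * p.2 k `^ r) _.
  apply: powR_jensen => // [k|]; first by apply/Re_ge0/mulcJ_ge0.
  have := E (fun=> 1); rewrite (specfun1 hp) app_id v1 => E1.
  by rewrite -[RHS]/(Re 1) E1; apply: eq_bigr => k _; rewrite mulr1.
apply: ler_sum => k _; rewrite ler_wpM2l //; first by apply/Re_ge0/mulcJ_ge0.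
rewrite /powf; case: ltP => // h.
have -> : p.2 k = 0 by apply/eqP; rewrite eq_le h hl.
by rewrite powR0 // gt_eqF.
Qed.

Lemma inner_psd_ge0 {T} (X : Op R T) v : psd X -> 0 <= Re (inner v (app X v)).
Proof. by move=> /psdP h; apply: Re_ge0. Qed.

Lemma tr_eigbasis {T} (X Y : Op R T) p : specdec X p ->
  trO Y = \sum_k inner (eigv p k) (app Y (eigv p k)).
Proof.
move=> hp; rewrite -[Y in LHS]mulO1 -(specfun1 hp) trOC /trO /mulO /specfun.
under eq_bigr do under eq_bigr do rewrite big_distrl /=.
under eq_bigr do rewrite exchange_big /=.
rewrite exchange_big /=; apply: eq_bigr => k _.
rewrite exchange_big /= /inner /app; apply: eq_bigr => a _.
rewrite big_distrr /=; apply: eq_bigr => b _.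
by rewrite {1}/cR complexr0 mul1r /eigv; ring.
Qed.

(** In an eigenbasis of X the trace is the sum of x_k <e_k, Y e_k>. Scalar Young applies termwise,
    and [inner_jensen] moves the power a' inside the expectation of Y. *)
Lemma tr_young {T} (X Y : Op R T) (a a' : R) : psd X -> psd Y -> 1 < a -> 1 < a' ->
  a^-1 + a'^-1 = 1 ->
  Re (trO (mulO X Y)) <= Re (trO (mpow X a)) / a + Re (trO (mpow Y a')) / a'.
Proof.
move=> hX hY ha ha' haa; have [p hp] := spectral_theorem (psd_herm hX).
have hl k := psd_spec_ge0 k hX hp.
rewrite trOC (tr_eigbasis (mulO Y X) hp) (tr_eigbasis (mpow Y a') hp).
rewrite mpowE (fcalc_spec _ hp) (tr_specfun _ hp) !Re_sum !mulr_suml -big_split /=.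
apply: ler_sum => k _.
rewrite app_mul (specdec_eig _ hp) appZv innerZr Re_cRM.
set z := Re (inner _ (app Y _)).
have z0 : 0 <= z by apply: inner_psd_ge0.
have a0 : 0 < a by lra. have a'0 : 0 < a' by lra.
apply: le_trans (conjugate_powR (hl k) z0 a0 a'0 haa) _; rewrite lerD //.
  rewrite ler_wpM2r ?invr_ge0 ?(ltW a0) // /powf; case: ltP => // h.
  have -> : p.2 k = 0 by apply/eqP; rewrite eq_le h hl.
  by rewrite powR0 // gt_eqF.
rewrite ler_wpM2r ?invr_ge0 ?(ltW a'0) // inner_jensen //.
by rewrite (specdec_orth _ _ hp) eqxx.
Qed.

(** K intertwines K K^* with K^* K, hence also their powers; splitting off one factor and cyclicity
    of the trace carry K to the other side. *)
Lemma tr_mpow_gram {T} (K : Op R T) r :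
  trO (mpow (mulO K (adjO K)) r) = trO (mpow (mulO (adjO K) K) r).
Proof.
have h1 := psd_gram K; have h2 := psd_gram (adjO K); rewrite adjOK in h2.
have I := fcalc_intertwine (powf (r - 1)) (psd_herm h1) (psd_herm h2)
  (esym (mulOA K (adjO K) K)).
have F (X : Op R T) : psd X -> mpow X r = mulO (mpow X (r - 1)) X.
  by move=> h; rewrite -{3}(mpow1 h) mpowD // subrK.
by rewrite (F _ h1) (F _ h2) mulOA mpowE I -mulOA trOC -mulOA -mpowE.
Qed.

(** An eigenvector of P X P with positive eigenvalue lies in the range of P, so the eigenvalue is an
    expectation of X and Jensen applies. The other eigenvalues contribute 0 on the left and a
    nonnegative term on the right. *)
Lemma tr_mpow_pinch {T} (P X : Op R T) r : psd X -> adjO P = P -> mulO P P = P -> 1 < r ->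
  Re (trO (mpow (mulO (mulO P X) P) r)) <= Re (trO (mulO P (mpow X r))).
Proof.
move=> hX hP hPP hr; set Y := mulO (mulO P X) P.
have hY : psd Y by rewrite /Y -{2}hP; apply: psd_conj.
have [p hp] := spectral_theorem (psd_herm hY).
have hl k := psd_spec_ge0 k hY hp.
have -> : trO (mulO P (mpow X r)) = trO (mulO (mulO P (mpow X r)) P).
  by rewrite [RHS]trOC mulOA hPP.
rewrite (tr_eigbasis (mulO (mulO P (mpow X r)) P) hp) mpowE (fcalc_spec _ hp) (tr_specfun _ hp).
rewrite !Re_sum; apply: ler_sum => k _; rewrite Re_cR.
have hq : 0 <= Re (inner (eigv p k) (app (mulO (mulO P (mpow X r)) P) (eigv p k))).
  by apply: inner_psd_ge0; rewrite -{2}hP; apply: psd_conj; apply: mpow_psd.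
rewrite /powf; case: ltP => // lk.
have PE : app P (eigv p k) = eigv p k.
  have E := specdec_eig k hp.
  have : app P (app Y (eigv p k)) = app Y (eigv p k).
    by rewrite -app_mul /Y !mulOA hPP.
  rewrite E appZv => /(congr1 (fun f : T -> C => fun a => (cR (p.2 k))^-1 * f a)) h.
  have c0 : cR (p.2 k) != 0 by rewrite /cR complexr0 (inj_eq (@complexI R)) gt_eqF.
  apply/funext => a; have := congr1 (fun f : T -> C => f a) h => /=.
  by rewrite !mulrA mulVf // !mul1r.
have QE Z : inner (eigv p k) (app (mulO (mulO P Z) P) (eigv p k)) =
            inner (eigv p k) (app Z (eigv p k)).
  by rewrite !app_mul PE inner_adj hP PE.
have -> : p.2 k = Re (inner (eigv p k) (app X (eigv p k))).
  rewrite -QE -/Y (specdec_eig k hp) innerZr Re_cRM (specdec_orth _ _ hp) eqxx.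
  by rewrite mulr1.
by rewrite QE inner_jensen // (specdec_orth _ _ hp) eqxx.
Qed.

(* Variational form of data processing for the measurement {P, 1 - P}. *)
Lemma tr_proj_le {T} (P A sg : Op R T) (a s : R) : 1 < a -> psd A -> psd sg ->
  adjO P = P -> mulO P P = P ->
  s = (a - 1) / (2 * a) ->
  Re (trO (mulO P (mulO (mulO (mpow sg s) A) (mpow sg s)))) <=
  Re (trO (mpow A a)) / a + (1 - a^-1) * Re (trO (mulO P sg)).
Proof.
move=> ha hA hsg hP hPP hs.
pose a' := a / (a - 1).
have ha' : 1 < a' by rewrite /a' ltr_pdivlMr; lra.
have haa : a^-1 + a'^-1 = 1 by rewrite /a'; field; apply/andP; split; lra.
(* K K^* is the factor paired with A under the trace, while K^* K = P sg^(2s) P is a compression, to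
   which [tr_mpow_pinch] applies; [tr_mpow_gram] switches between them. *)
pose K := mulO (mpow sg s) P.
have KK : mulO K (adjO K) = mulO (mulO (mpow sg s) P) (mpow sg s).
  by rewrite /K adjOM hP mpow_adj // -!mulOA [mulO P (mulO P _)]mulOA hPP.
have KK' : mulO (adjO K) K = mulO (mulO P (mpow sg (s + s))) P.
  by rewrite /K adjOM hP mpow_adj // -mpowD // !mulOA.
have -> : trO (mulO P (mulO (mulO (mpow sg s) A) (mpow sg s))) = trO (mulO A (mulO K (adjO K))).
  by rewrite KK trOC -!mulOA trOC -!mulOA.
apply: le_trans (tr_young hA (psd_gram K) ha ha' haa) _.
rewrite lerD2l tr_mpow_gram KK' mulrC.
have -> : 1 - a^-1 = a'^-1 by lra.
apply: ler_wpM2l; first by rewrite invr_ge0; lra.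
apply: le_trans (tr_mpow_pinch (mpow_psd _ hsg) hP hPP ha') _.
rewrite mpow_comp //.
(* This is what fixes s: the conjugate power a' turns sg^(2s) back into sg. *)
have -> : (s + s) * a' = 1 by rewrite hs /a'; field; apply/andP; split; lra.
by rewrite mpow1.
Qed.

End TraceIneq.

(** * Smoothing *)

Section Smoothing.
Variable R : realType.
Local Notation C := R[i].
Local Notation Re := (@complex.Re R).
Implicit Types T A B : finType.

(** Suppose X - Y has a unit eigenvector v with eigenvalue m < 0. Then Y v = X v - m v, so |Y v|^2 =
    |X v|^2 - 2 m <v, X v> + m^2 > |X v|^2, against Y^2 <= X^2. *)
Lemma opmono_sqrt {T} (X Y : Op R T) : psd X -> psd Y ->
  loewner (mulO Y Y) (mulO X X) -> loewner Y X.
Proof.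
move=> hX hY /psdP h; set Z := subO X Y.
have hXa := psd_herm hX; have hYa := psd_herm hY.
have hZ : adjO Z = Z by rewrite adjOB hXa hYa.
rewrite /loewner -/Z.
have [p hp] := spectral_theorem hZ.
case: (hp) => _ ->; apply: (specfun_psd (f := id)) => k; rewrite leNgt; apply/negP => lk.
set v := eigv p k; set m := p.2 k in lk *.
have v1 : inner v v = 1 by rewrite (specdec_orth k k hp) eqxx.
have Yv : app Y v = fun a => app X v a + cR (- m) * v a.
  apply/funext => a; have := congr1 (fun f : T -> C => f a) (specdec_eig k hp).
  rewrite app_sub -/v -/m /= => /eqP; rewrite subr_eq => /eqP ->.
  by rewrite addrAC -mulrDl -cRD subrr /cR complexr0 mul0r add0r.
have := Re_ge0 (h v); have -> : app (subO (mulO X X) (mulO Y Y)) v =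
    fun a => app X (app X v) a - app Y (app Y v) a.
  by apply/funext => a; rewrite app_sub !app_mul.
rewrite innerBr (inner_adj X) (inner_adj Y) hXa hYa Yv innerDl !innerDr !innerZl !innerZr v1.
rewrite -(inner_conj v (app X v)).
rewrite ReD ReN !ReD conj_cR !mulr1 !Re_cRM Re_conj Re_cR.
have xv := inner_psd_ge0 v hX.
nra.
Qed.

(** Cauchy-Schwarz for a unit vector, from |u - x v|^2 >= 0 with x = Re <u, v>. *)
Lemma inner_le_sqrt {T} (u v : T -> C) : inner v v = 1 ->
  Re (inner u v) <= Num.sqrt (Re (inner u u)).
Proof.
move=> v1; set x := Re (inner u v).
have h := Re_ge0 (inner_ge0 (fun a => u a + cR (- x) * v a)).
rewrite innerDl !innerDr !innerZl !innerZr v1 -(inner_conj u v) in h.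
rewrite !ReD conj_cR !mulr1 !Re_cRM Re_conj Re_cR -/x in h.
have [x0|x0] := ltP x 0; first by apply: le_trans (ltW x0) (sqrtr_ge0 _).
by rewrite -(ger0_norm x0) -sqrtr_sqr ler_wsqrtr //; nra.
Qed.

(** For a unit eigenvector e of K K^*, Re <e, K e> = Re <K^* e, e> is at most |K^* e|, the square
    root of the eigenvalue. *)
Lemma tr_le_sqrt_gram {T} (K : Op R T) :
  Re (trO K) <= Re (trO (msqrt (mulO K (adjO K)))).
Proof.
have [p hp] := spectral_theorem (psd_herm (psd_gram K)).
rewrite (tr_eigbasis K hp) /msqrt (fcalc_spec _ hp) (tr_specfun _ hp) !Re_sum.
apply: ler_sum => k _; rewrite Re_cR inner_adj.
have v1 : inner (eigv p k) (eigv p k) = 1 by rewrite (specdec_orth _ _ hp) eqxx.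
apply: le_trans (inner_le_sqrt _ v1) _; apply: ler_wsqrtr.
rewrite -(inner_adj K) -app_mul (specdec_eig _ hp) innerZr v1 Re_cRM mulr1 //.
Qed.

Lemma exists_pos_part {T} (X : Op R T) : adjO X = X ->
  exists P D, [/\ adjO P = P, mulO P P = P, psd D, loewner X D & D = mulO P X].
Proof.
move=> hX; exists (fcalc (fun x : R => (0 < x)%R%:R) X), (fcalc (fun x : R => (0 < x)%R%:R * x) X).
split.
- exact: fcalc_adj.
- rewrite fcalcM //; congr fcalc; apply/funext => x.
  by case: (0 < x); rewrite ?mulr1 ?mulr0.
- by apply: fcalc_psd => // x; case: (ltP 0 x) => h; rewrite ?mul1r ?mul0r // ltW.
- rewrite /loewner -[X in subO _ X](fcalc_id hX) fcalcB //.
  apply: fcalc_psd => // x; case: (ltP 0 x) => h; rewrite ?mul1r ?mul0r ?subrr //.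
  by rewrite sub0r oppr_ge0.
- by rewrite -{3}(fcalc_id hX) fcalcM.
Qed.

Lemma subO_split {T} (X Y Z : Op R T) : subO X Z = addO (subO X Y) (subO Y Z).
Proof. by apply: eqO => a b; rewrite /subO /addO addrA subrK. Qed.

Lemma psd_compl_supp {T} (X : Op R T) : psd X -> psd (subO oneO (mpow X 0)).
Proof.
move=> hX; have [p hp] := spectral_theorem (psd_herm hX).
rewrite mpowE (fcalc_spec _ hp) -(specfun1 hp).
have -> : subO (specfun (fun=> 1) p) (specfun (powf 0) p) = specfun (fun x => 1 - powf 0 x) p.
  apply: eqO => a b; rewrite /subO -sumrB; apply: eq_bigr => k _.
  by rewrite -!mulrBl /cR !complexr0 rmorphB.
apply: specfun_psd => k; rewrite /powf; case: ifP; last by rewrite subr0.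
by rewrite powRr0 subrr.
Qed.

(* The smoothed state is [G rho G^*] with [G = sg^(1/2) (sg + D)^(-1/2)]. *)
Lemma smoothing {T} (rho sg D : Op R T) : psd rho -> trO rho = 1 -> psd sg -> psd D ->
  loewner rho (addO sg D) ->
  exists rt, [/\ dens_le rt, loewner rt sg & 1 - Re (trO D) <= gfid rt rho].
Proof.
move=> hr r1 hs hD hle; set W := addO sg D in hle *.
have hW : psd W by apply: psd_add.
pose X := mpow W 2^-1; pose Y := mpow sg 2^-1; pose V := mpow W (- 2^-1).
have hXX : mulO X X = W := mpow_half hW.
have hYY : mulO Y Y = sg := mpow_half hs.
have Xa : adjO X = X := mpow_adj _ hW.
have Ya : adjO Y = Y := mpow_adj _ hs.
have Va : adjO V = V := mpow_adj _ hW.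
have VX : mulO V X = mpow W 0 by rewrite /V /X mpowD // addNr.
have XV : mulO X V = mpow W 0 by rewrite /V /X mpowD // subrr.
have PX : mulO (mpow W 0) X = X by rewrite /X mpowD // add0r.
have WV : mulO W V = X by rewrite -hXX -mulOA XV /X mpowD // addr0.
have VW : mulO V W = X by rewrite -hXX mulOA VX PX.
have VWV : mulO (mulO V W) V = mpow W 0 by rewrite VW XV.
pose G := mulO Y V.
have Ga : adjO G = mulO V Y by rewrite adjOM Ya Va.
have sgW : psd (subO W sg).
  have -> : subO W sg = D by apply: eqO => a b; rewrite /subO /W /addO addrC addKr.
  exact: hD.
(* G^* G = V sg V <= V W V = W^0 <= 1, because sg <= W. *)
have GG : psd (subO oneO (mulO (adjO G) G)).
  rewrite (subO_split _ (mpow W 0)); apply: psd_add; first exact: psd_compl_supp.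
  rewrite -{1}VWV Ga /G -!mulOA [mulO Y (mulO Y V)]mulOA hYY -mulOBr -mulOBl mulOA.
  by rewrite -{2}Va; apply: psd_conj.
pose rt := mulO (mulO G rho) (adjO G).
have hrt : psd rt by apply: psd_conj.
exists rt; split.
- split => //; rewrite /rt -mulOA trOC -mulOA -r1 -subr_ge0.
  by have := tr_mul_ge0 hr GG; rewrite mulOBr mulO1 trOB.
(* From rho <= W follows rt <= G W G^* = sg^(1/2) W^0 sg^(1/2) <= sg. *)
- rewrite /loewner (subO_split _ (mulO (mulO G W) (adjO G))); apply: psd_add.
    have -> : mulO (mulO G W) (adjO G) = mulO (mulO Y (mpow W 0)) Y.
      by rewrite Ga /G -VWV !mulOA.
    rewrite -{1}hYY -{1}[Y]mulO1 -mulOBl -mulOBr -{2}Ya.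
    by apply: psd_conj; apply: psd_compl_supp.
  by rewrite /rt -mulOBl -mulOBr; apply: psd_conj.
- rewrite /gfid r1 /= subrr mulr0 sqrtr0 addr0 /trnorm.
  pose S := mpow rho 2^-1.
  have hSS : mulO S S = rho := mpow_half hr.
  have Sa : adjO S = S := mpow_adj _ hr.
  have hSrt : mulO (msqrt rt) (msqrt rt) = rt by rewrite msqrtE // mpow_half.
  have art : adjO (msqrt rt) = msqrt rt by rewrite msqrtE // mpow_adj.
  (* The Gram operator in the fidelity equals that of S G S, so the fidelity is at least Re tr (S G
     S) = Re tr (G rho). *)
  have -> : mulO (adjO (mulO (msqrt rt) (msqrt rho))) (mulO (msqrt rt) (msqrt rho)) =
            mulO (mulO (mulO S G) S) (adjO (mulO (mulO S G) S)).
    rewrite (msqrtE hr) -/S !adjOM Sa art -!mulOA.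
    rewrite [mulO (msqrt rt) (mulO (msqrt rt) S)]mulOA hSrt.
    by rewrite /rt /G !adjOM -!mulOA [mulO S (mulO S _)]mulOA hSS.
  apply: le_trans (tr_le_sqrt_gram _).
  rewrite -mulOA trOC -mulOA hSS.
  (* H equals 2 - G - G^* and is positive as a sum of two positive terms. Hence tr (H rho) <= tr (H
     W), that is, 1 - Re tr (G rho) <= tr W - Re tr (G W). *)
  pose H := addO (subO oneO (mulO (adjO G) G)) (mulO (adjO (subO oneO G)) (subO oneO G)).
  have hH : psd H.
    by apply: psd_add => //; rewrite -{2}[subO oneO G]adjOK; apply: psd_gram.
  have HE : H = subO (subO (addO oneO oneO) G) (adjO G).
    rewrite /H adjOB adjO1 mulOBl !mulOBr !mul1O mulO1; apply: eqO => a b.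
    by rewrite /subO /addO; ring.
  have := Re_ge0 (tr_mul_ge0 hH hle).
  rewrite HE !mulOBl !trOB !mulOBr !trOB !mulODl !mul1O !trOD.
  have aE Z : psd Z -> Re (trO (mulO (adjO G) Z)) = Re (trO (mulO G Z)).
    by move=> hZ; rewrite -[RHS]Re_conj -trO_adj adjOM (psd_herm hZ) trOC.
  have GW : trO (mulO G W) = trO (mulO Y X) by rewrite /G -mulOA VW.
  rewrite !(ReD, ReN) !aE // GW r1.
  (* Since tr (G W) = tr (sg^(1/2) W^(1/2)), monotonicity of the square root gives tr (G W) >= tr
     sg, and what remains is tr W - tr sg = tr D. *)
  have : loewner Y X by apply: opmono_sqrt => //; [apply: mpow_psd|apply: mpow_psd|rewrite hXX hYY].
  move=> /(tr_mul_ge0 (mpow_psd 2^-1 hs)) /Re_ge0; rewrite -/Y mulOBr trOB hYY ReD ReN.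
  rewrite /=; lra.
Qed.

(** * The sandwiched quantity Q *)

Definition sandw {T} (a : R) (rho sg : Op R T) : Op R T :=
  mulO (mulO (mpow sg ((1 - a) / (2 * a))) rho) (mpow sg ((1 - a) / (2 * a))).
Definition Qsand {T} (a : R) (rho sg : Op R T) : R := Re (trO (mpow (sandw a rho sg) a)).

Lemma sandw_psd {T} a (rho sg : Op R T) : psd rho -> psd sg -> psd (sandw a rho sg).
Proof.
by move=> hr hs; rewrite /sandw -{2}(mpow_adj ((1 - a) / (2 * a)) hs); apply: psd_conj.
Qed.

Lemma suppM_r {T} (X Y : Op R T) : psd X -> psd Y -> mulO (mpow Y 0) X = X ->
  mulO X (mpow Y 0) = X.
Proof.
by move=> hX hY /(congr1 (@adjO R T)); rewrite adjOM (psd_herm hX) (mpow_adj 0 hY).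
Qed.

Lemma sandwK {T} a (rho sg : Op R T) : psd rho -> psd sg -> mulO (mpow sg 0) rho = rho ->
  mulO (mulO (mpow sg ((a - 1) / (2 * a))) (sandw a rho sg)) (mpow sg ((a - 1) / (2 * a))) = rho.
Proof.
move=> hr hs h; rewrite /sandw.
have e1 : (a - 1) / (2 * a) + (1 - a) / (2 * a) = 0 :> R.
  by rewrite -mulrDl addrA subrK subrr mul0r.
rewrite !mulOA mpowD // e1 -!mulOA mpowD // addrC e1 !mulOA h.
exact: suppM_r.
Qed.

Lemma tr_proj_Qsand {T} (P rho sg : Op R T) (a : R) : 1 < a -> psd rho -> psd sg ->
  adjO P = P -> mulO P P = P -> mulO (mpow sg 0) rho = rho ->
  Re (trO (mulO P rho)) <= Qsand a rho sg / a + (1 - a^-1) * Re (trO (mulO P sg)).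
Proof.
move=> ha hr hs hP hPP h; rewrite -{1}(sandwK a hr hs h).
by apply: tr_proj_le => //; apply: sandw_psd.
Qed.

(** The projection inequality at P = 1 reads 1 <= Q/a + (1 - 1/a) tr sg, and tr sg <= 1. The bound
    makes divergences nonnegative and keeps arguments of logarithms positive. *)
Lemma Qsand_ge1 {T} (rho sg : Op R T) (a : R) : 1 < a -> psd rho -> trO rho = 1 ->
  dens_le sg -> mulO (mpow sg 0) rho = rho -> 1 <= Qsand a rho sg.
Proof.
move=> ha hr r1 [hs s1] h.
have := tr_proj_Qsand ha hr hs (@adjO1 R T) (mulO1 oneO) h.
rewrite !mul1O r1 => /=; have := Re_le s1 => /= s1' h1.
have a0 : 0 < a by lra.
have ia : a^-1 < 1 by rewrite invf_lt1.
have : 1 <= Qsand a rho sg / a + (1 - a^-1).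
  by apply: le_trans h1 _; rewrite lerD2l ler_piMr // subr_ge0 ltW.
rewrite -[leLHS](divff (lt0r_neq0 a0)) => h2.
have : 1 / a <= Qsand a rho sg / a by move: h2; rewrite mulfV ?gt_eqF // div1r; lra.
by rewrite ler_pM2r // invr_gt0.
Qed.

Lemma sandw_scale {T} a c (rho sg : Op R T) : 0 <= c -> psd sg ->
  sandw a rho (scaleO (cR c) sg) =
  scaleO (cR (powf ((1 - a) / (2 * a)) c * powf ((1 - a) / (2 * a)) c)) (sandw a rho sg).
Proof.
by move=> hc hs; rewrite /sandw mpow_scale // !mulOZl !mulOZr scaleOA -cRM.
Qed.

Lemma Qsand_scale {T} a c (rho sg : Op R T) : 1 < a -> 0 < c -> psd rho -> psd sg ->
  Qsand a rho (scaleO (cR c) sg) = c `^ (1 - a) * Qsand a rho sg.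
Proof.
move=> ha hc hr hs; rewrite /Qsand sandw_scale //; last exact: ltW.
rewrite mpow_scale; [|by rewrite mulr_ge0 ?powf_ge0|exact: sandw_psd].
rewrite trOZ Re_cRM powfD powf_comp /powf hc; congr (_ `^ _ * _).
by field; lra.
Qed.

(** Let P project onto the positive part D of rho - l sg, with p = tr (P rho) and q = l tr (P sg).
    Since q <= p, the inequality p <= d/a + (1 - 1/a) q yields p <= d, hence tr D = p - q <= d: the
    factor 1/a cancels. *)
Lemma smooth_bound {T} (rho sg : Op R T) (a d l : R) : 1 < a -> psd rho -> trO rho = 1 ->
  psd sg -> mulO (mpow sg 0) rho = rho -> 0 < l -> l `^ (1 - a) * Qsand a rho sg = d ->
  exists rt, [/\ dens_le rt, loewner rt (scaleO (cR l) sg) & 1 - d <= gfid rt rho].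
Proof.
move=> ha hr r1 hs h hl hd.
have hs' : psd (scaleO (cR l) sg) by apply: psd_scale; rewrite ?cR_ge0 ?ltW.
set sg' := scaleO _ _ in hs' *.
have h' : mulO (mpow sg' 0) rho = rho.
  by rewrite /sg' mpow_scale ?ltW // /powf hl powRr0 scale1O.
have [|P [D [hP hPP hD hle DE]]] := @exists_pos_part _ (subO rho sg').
  by rewrite adjOB (psd_herm hr) (psd_herm hs').
have [|rt [h1 h2 h3]] := smoothing hr r1 hs' hD.
  rewrite /loewner; move: hle; rewrite /loewner; congr psd.
  by apply: eqO => x y; rewrite /subO /addO; ring.
exists rt; split => //; apply: le_trans h3.
have := tr_proj_Qsand ha hr hs' hP hPP h'.
rewrite Qsand_scale // hd.
have hPpsd : psd P by rewrite -hPP -{2}hP; apply: psd_gram.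
have q0 := Re_ge0 (tr_mul_ge0 hPpsd hs').
have d0 := Re_ge0 (psd_tr hD).
move: d0; rewrite DE mulOBr trOB ReD ReN => d0 p1.
set p := Re (trO (mulO P rho)) in d0 p1 *; set q := Re (trO (mulO P sg')) in d0 q0 p1 *.
have a0 : 0 < a by lra.
have ia : a^-1 < 1 by rewrite invf_lt1.
have : p <= d / a + (1 - a^-1) * p.
  by apply: le_trans p1 _; rewrite lerD2l ler_wpM2l //; lra.
have : 0 < a^-1 by rewrite invr_gt0.
nra.
Qed.

End Smoothing.

(** * Partial traces and channels *)

Section Channels.
Variable R : realType.
Local Notation C := R[i].
Local Notation Re := (@complex.Re R).
Implicit Types T A B J L : finType.

Lemma sum_pair {A B} (F : A * B -> C) : \sum_p F p = \sum_a \sum_b F (a, b).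
Proof. by rewrite pair_bigA; apply: eq_bigr => -[]. Qed.

Lemma tensM {A B} (X X' : Op R A) (Y Y' : Op R B) :
  mulO (tensO X Y) (tensO X' Y') = tensO (mulO X X') (mulO Y Y').
Proof.
apply: eqO => -[a b] [a' b']; rewrite /mulO /tensO /=.
rewrite sum_pair /= big_distrl /=.
apply: eq_bigr => c _; rewrite big_distrr /=; apply: eq_bigr => d _.
by rewrite mulrACA.
Qed.
Lemma adj_tens {A B} (X : Op R A) (Y : Op R B) : adjO (tensO X Y) = tensO (adjO X) (adjO Y).
Proof. by apply: eqO => -[a b] [a' b']; rewrite /adjO /tensO /= conjM. Qed.
Lemma tr_tens {A B} (X : Op R A) (Y : Op R B) : trO (tensO X Y) = trO X * trO Y.
Proof.
rewrite /trO sum_pair big_distrl /=.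
by apply: eq_bigr => a _; rewrite big_distrr.
Qed.
Lemma tens_scalel {A B} c (X : Op R A) (Y : Op R B) : tensO (scaleO c X) Y = scaleO c (tensO X Y).
Proof. by apply: eqO => a b; rewrite /tensO /scaleO mulrA. Qed.
Lemma dens_le_tens {A B} (X : Op R A) (Y : Op R B) : dens_le X -> dens_le Y -> dens_le (tensO X Y).
Proof.
move=> [hX x1] [hY y1]; split; first exact: psd_tens.
by rewrite tr_tens mulr_ile1 ?psd_tr.
Qed.

Lemma mul_tens1l {A J} (K : Op R J) (X : Op R (A * J)%type) a j y :
  mulO (tensO oneO K) X (a, j) y = \sum_c K j c * X (a, c) y.
Proof.
rewrite /mulO sum_pair /=.
rewrite -(sum_delta_l (fun d => \sum_c K j c * X (d, c) y)); apply: eq_bigr => d _.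
by rewrite big_distrr /=; apply: eq_bigr => c _; rewrite /tensO /oneO /= mulrA.
Qed.
Lemma mul_tens1r {A J} (K : Op R J) (X : Op R (A * J)%type) x a j :
  mulO X (tensO oneO K) x (a, j) = \sum_c X x (a, c) * K c j.
Proof.
rewrite /mulO sum_pair /=.
rewrite -(sum_delta_r (fun d => \sum_c X x (d, c) * K c j)); apply: eq_bigr => d _.
rewrite big_distrl /=; apply: eq_bigr => c _; rewrite /tensO /oneO /=; ring.
Qed.
Lemma mul_tensl1 {J L} (K : Op R J) (X : Op R (J * L)%type) j l y :
  mulO (tensO K oneO) X (j, l) y = \sum_c K j c * X (c, l) y.
Proof.
rewrite /mulO sum_pair /=.
apply: eq_bigr => c _; rewrite -(sum_delta_l (fun d => K j c * X (c, d) y)).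
by apply: eq_bigr => d _; rewrite /tensO /oneO /=; ring.
Qed.
Lemma mul_tensr1 {J L} (K : Op R J) (X : Op R (J * L)%type) x j l :
  mulO X (tensO K oneO) x (j, l) = \sum_c X x (c, l) * K c j.
Proof.
rewrite /mulO sum_pair /=.
apply: eq_bigr => c _; rewrite -(sum_delta_r (fun d => X x (c, d) * K c j)).
by apply: eq_bigr => d _; rewrite /tensO /oneO /=; ring.
Qed.

(** The test vector is the push-forward of v along f. As f may be any map, this covers both
    relabelling a basis and selecting a block for a partial trace. *)
Lemma psd_pullback {T T' : finType} (f : T' -> T) (Z : Op R T) :
  psd Z -> psd (fun x y => Z (f x) (f y)).
Proof.
move=> /psdP h; apply/psdP => v.
have := h (fun t => \sum_x (t == f x)%:R * v x); congr (_ <= _).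
have E (g : T -> C) : \sum_t g t * (\sum_x (t == f x)%:R * v x) = \sum_x g (f x) * v x.
  under eq_bigr do rewrite big_distrr /=.
  rewrite exchange_big /=; apply: eq_bigr => x _.
  under eq_bigr do rewrite mulrA.
  by rewrite -big_distrl /= sum_delta_r.
rewrite -inner_conj /inner E conj_sum; apply: eq_bigr => x _.
by rewrite conjM conjcK mulrC; congr (_ * _); rewrite /app E.
Qed.

Lemma psd_sum {I T : finType} (F : I -> Op R T) :
  (forall i, psd (F i)) -> psd (fun x y => \sum_i F i x y).
Proof.
move=> h; apply/psdP => v.
have -> : app (fun x y => \sum_i F i x y) v = fun a => \sum_i app (F i) v a.
  apply/funext => a; rewrite /app; under eq_bigr do rewrite big_distrl /=.
  by rewrite exchange_big.
rewrite /inner; under eq_bigr do rewrite big_distrr /=.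
rewrite exchange_big /=; apply: sumr_ge0 => i _.
by have /psdP/(_ v) := h i.
Qed.

Lemma psd_ptr1 {A B} (X : Op R (A * B)%type) : psd X -> psd (ptr1 X).
Proof. by move=> h; apply: psd_sum => a; apply: (psd_pullback (fun b => (a, b))). Qed.
Lemma tr_ptr1 {A B} (X : Op R (A * B)%type) : trO (ptr1 X) = trO X.
Proof. by rewrite /trO /ptr1 exchange_big /= sum_pair. Qed.
Lemma tr_ptr2 {A B} (X : Op R (A * B)%type) : trO (ptr2 X) = trO X.
Proof. by rewrite /trO /ptr2 sum_pair. Qed.
Lemma ptr1_mull {A J} (K : Op R J) (X : Op R (A * J)%type) :
  ptr1 (mulO (tensO oneO K) X) = mulO K (ptr1 X).
Proof.
apply: eqO => j j'; rewrite /ptr1 /mulO; under eq_bigr do rewrite -/(mulO _ _ _ _) mul_tens1l.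
by rewrite exchange_big /=; apply: eq_bigr => c _; rewrite big_distrr.
Qed.
Lemma ptr1_mulr {A J} (K : Op R J) (X : Op R (A * J)%type) :
  ptr1 (mulO X (tensO oneO K)) = mulO (ptr1 X) K.
Proof.
apply: eqO => j j'; rewrite /ptr1 /mulO; under eq_bigr do rewrite -/(mulO _ _ _ _) mul_tens1r.
by rewrite exchange_big /=; apply: eq_bigr => c _; rewrite big_distrl.
Qed.
Lemma ptr1_scale {A J} c (X : Op R (A * J)%type) : ptr1 (scaleO c X) = scaleO c (ptr1 X).
Proof. by apply: eqO => j j'; rewrite /ptr1 /scaleO big_distrr. Qed.

(** For Q = 1 - 1 (x) P the trace of Q X is that of (1 - P) X_J, which is 0; positivity of X then
    forces Q X = 0. *)
Lemma supp_ptr1 {A J} (X : Op R (A * J)%type) (P : Op R J) : psd X ->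
  adjO P = P -> mulO P P = P -> mulO P (ptr1 X) = ptr1 X -> mulO (tensO oneO P) X = X.
Proof.
move=> hX hP hPP h; pose Q : Op R (A * J)%type := subO oneO (tensO oneO P).
have hQ : adjO Q = Q by rewrite adjOB adj_tens !adjO1 hP.
have hQQ : mulO Q Q = Q.
  rewrite /Q mulOBl mul1O mulOBr mulO1 tensM mulO1 hPP.
  by apply: eqO => x y; rewrite /subO subrr subr0.
have : mulO Q X = fun _ _ => 0.
  apply: mulO_eq0 => //; rewrite /Q mulOBl mul1O trOB -!tr_ptr1 ptr1_mull h.
  exact: subrr.
rewrite /Q mulOBl mul1O => E; apply: eqO => x y.
have := congr1 (fun Z : Op R _ => Z x y) E.
by rewrite /subO => /eqP; rewrite subr_eq0 => /eqP <-.
Qed.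

Section Chan.
Variables (A J N L : finType) (M : Op R A -> Op R (N * L)%type).
Hypothesis chM : channel M.

Lemma chan_sum {I : finType} (c : I -> C) (X : I -> Op R A) :
  M (fun a a' => \sum_i c i * X i a a') = fun b b' => \sum_i c i * M (X i) b b'.
Proof.
have [lin _] := chM.
(* The coefficient -1 gives M 0 = - M 0 + M 0. *)
have M0 : M (fun _ _ => 0) = fun _ _ => 0.
  have := lin (-1) (fun _ _ => 0) (fun _ _ => 0).
  have -> : addO (scaleO (-1) (fun _ _ => 0)) (fun _ _ => 0) = (fun _ _ => 0) :> Op R A.
    by apply: eqO => a b; rewrite /addO /scaleO mulr0 addr0.
  move=> ->; apply: eqO => a b; rewrite /addO /scaleO; ring.
have E (s : seq I) : M (fun a a' => \sum_(i <- s) c i * X i a a') =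
    fun b b' => \sum_(i <- s) c i * M (X i) b b'.
  elim: s => [|i s IH].
    rewrite [X in M X](_ : _ = fun _ _ => 0); last by apply: eqO => a b; rewrite big_nil.
    by rewrite M0; apply: eqO => a b; rewrite big_nil.
  rewrite [X in M X](_ : _ = addO (scaleO (c i) (X i)) (fun a a' => \sum_(i <- s) c i * X i a a')).
    by rewrite lin IH; apply: eqO => a b; rewrite big_cons.
  by apply: eqO => a b; rewrite big_cons.
exact: E.
Qed.

(* [outO] is [out_JL] for an arbitrary side register. *)
Definition outO (X : Op R (A * J)%type) : Op R (J * L)%type :=
  fun jl jl' => \sum_r chan_id M X ((r, jl.2), jl.1) ((r, jl'.2), jl'.1).

(** The channel is the identity on J: each block of the product is a linear combination of blocks of
    X, and M acts blockwise. Thus powers of operators on J pass through the channel. *)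
Lemma outO_mull (K : Op R J) X : outO (mulO (tensO oneO K) X) = mulO (tensO K oneO) (outO X).
Proof.
apply: eqO => -[j l] [j' l']; rewrite mul_tensl1 /outO /chan_id /=.
under [RHS]eq_bigr do rewrite big_distrr /=.
rewrite exchange_big /=; apply: eq_bigr => r _.
have /= <- := congr1 (fun Z : Op R _ => Z (r, l) (r, l')) (chan_sum (K j) (fun c a a' => X (a, c) (a', j'))).
by congr (M _ _ _); apply: eqO => a a'; rewrite mul_tens1l.
Qed.
Lemma outO_mulr (K : Op R J) X : outO (mulO X (tensO oneO K)) = mulO (outO X) (tensO K oneO).
Proof.
apply: eqO => -[j l] [j' l']; rewrite mul_tensr1 /outO /chan_id /=.
under [RHS]eq_bigr do rewrite big_distrl /=.
rewrite exchange_big /=; apply: eq_bigr => r _.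
under [RHS]eq_bigr do rewrite mulrC.
have /= <- := congr1 (fun Z : Op R _ => Z (r, l) (r, l')) (chan_sum (fun c => K c j') (fun c a a' => X (a, j) (a', c))).
congr (M _ _ _); apply: eqO => a a'; rewrite mul_tens1r.
by apply: eq_bigr => c _; rewrite mulrC.
Qed.
Lemma outO_scale c X : outO (scaleO c X) = scaleO c (outO X).
Proof.
apply: eqO => -[j l] [j' l']; rewrite /outO /chan_id /scaleO big_distrr /=.
apply: eq_bigr => r _; have := chan_sum (fun _ : unit => c) (fun _ a a' => X (a, j) (a', j')).
rewrite [X in M X](_ : _ = fun a a' => c * X (a, j) (a', j')); last first.
  by apply: eqO => a b; rewrite big_const /= card_unit /= addr0.
by move=> ->; rewrite big_const /= card_unit /= addr0.
Qed.
Lemma outO_psd X : psd X -> psd (outO X).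
Proof.
have [_ [cp _]] := chM => /cp h; apply: psd_sum => r.
by apply: (psd_pullback (fun jl : J * L => ((r, jl.2), jl.1))).
Qed.
Lemma ptr2_outO X : ptr2 (outO X) = ptr1 X.
Proof.
have [_ [_ tp]] := chM; apply: eqO => j j'; rewrite /ptr2 /outO /chan_id /=.
have := tp (fun a a' => X (a, j) (a', j')); rewrite /ptr1 {2}/trO => <-.
by rewrite exchange_big /= /trO sum_pair.
Qed.
Lemma tr_outO X : trO (outO X) = trO X.
Proof. by rewrite -tr_ptr2 ptr2_outO tr_ptr1. Qed.

(* Writing A for the sandwiched marginal w^-s rho_J w^-s with s = (a-1)/2a,
   the input sigma is A^((a-1)/2) w^-s rho w^-s A^((a-1)/2) / tr A^a; its
   marginal is A^a / tr A^a, which makes the chain rule an equality. *)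
Lemma chain_step (a : R) (rho : Op R (A * J)%type) (w : Op R J) : 1 < a ->
  dens_eq rho -> dens_le w -> mulO (mpow w 0) (ptr1 rho) = ptr1 rho ->
  exists2 sigma : Op R (A * J)%type, dens_eq sigma &
  forall tau : Op R L, psd tau ->
    mulO (mpow (tensO (ptr1 sigma) tau) 0) (outO sigma) = outO sigma ->
    mulO (mpow (tensO w tau) 0) (outO rho) = outO rho /\
    Qsand a (outO rho) (tensO w tau) =
      Qsand a (ptr1 rho) w * Qsand a (outO sigma) (tensO (ptr1 sigma) tau).
Proof.
move=> ha [hr r1] hw hsupp; have [w0 _] := hw.
have hrJ : psd (ptr1 rho) by apply: psd_ptr1.
set q := Qsand a (ptr1 rho) w.
have q1 : 1 <= q by apply: Qsand_ge1 => //; rewrite tr_ptr1.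
have q0 : 0 < q by lra.
set s := (1 - a) / (2 * a); set u := (a - 1) / 2.
have a0 : a != 0 by lra.
(* The marginal of sigma is proportional to A^a, so its power s is proportional to A^(a s) = A^(-u),
   which undoes the A^u built into sigma. *)
have as_u : a * s = - u by rewrite /s /u; field.
set Wn := mpow w s; set Wp := mpow w (- s).
have WpWn : mulO Wp Wn = mpow w 0 by rewrite mpowD // addNr.
have WnWp : mulO Wn Wp = mpow w 0 by rewrite mpowD // subrr.
set Ao := sandw a (ptr1 rho) w.
have hA : psd Ao by apply: sandw_psd.
set Bo : Op R (A * J)%type := mulO (mulO (tensO oneO Wn) rho) (tensO oneO Wn).
have Wna : adjO Wn = Wn := mpow_adj s w0.
have hB : psd Bo.
  by rewrite /Bo -{2}Wna -{2}(@adjO1 R A) -adj_tens; apply: psd_conj.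
have pB : ptr1 Bo = Ao by rewrite /Bo ptr1_mulr ptr1_mull.
have proj T (X : Op R T) : psd X -> adjO (mpow X 0) = mpow X 0 /\ mulO (mpow X 0) (mpow X 0) = mpow X 0.
  by move=> hX; rewrite mpow_adj // mpowD // addr0.
have [PAa PAA] := proj _ _ hA; have [Pwa Pww] := proj _ _ w0.
have PB : mulO (tensO oneO (mpow Ao 0)) Bo = Bo.
  by apply: supp_ptr1 => //; rewrite pB suppM.
have Pr : mulO (tensO oneO (mpow w 0)) rho = rho by apply: supp_ptr1.
have tA0 t : adjO (tensO (@oneO R A) (mpow Ao t)) = tensO oneO (mpow Ao t).
  by rewrite adj_tens adjO1 mpow_adj.
have PBr : mulO Bo (tensO oneO (mpow Ao 0)) = Bo.
  by have := congr1 (@adjO R _) PB; rewrite adjOM (psd_herm hB) tA0.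
have Prr : mulO rho (tensO oneO (mpow w 0)) = rho.
  by have := congr1 (@adjO R _) Pr; rewrite adjOM (psd_herm hr) adj_tens adjO1 Pwa.
set Au := mpow Ao u; set An := mpow Ao (- u).
have AnAu : mulO An Au = mpow Ao 0 by rewrite /An mpowD // addNr.
have AuAn : mulO Au An = mpow Ao 0 by rewrite mpowD // subrr.
have AuAAu : mulO (mulO Au Ao) Au = mpow Ao a.
  by rewrite -{1}(mpow1 hA) /Au !mpowD //; congr mpow; rewrite /u; lra.
have trA : trO (mpow Ao a) = cR q by rewrite -[LHS]ReK //; apply/psd_tr/mpow_psd.
have c0 : 0 < q^-1 by rewrite invr_gt0.
set c := q^-1 in c0 *.
pose sg := scaleO (cR c) (mulO (mulO (tensO oneO Au) Bo) (tensO oneO Au)).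
have psg : ptr1 sg = scaleO (cR c) (mpow Ao a).
  by rewrite /sg ptr1_scale ptr1_mulr ptr1_mull pB AuAAu.
have sgJ t : mpow (ptr1 sg) t = scaleO (cR (powf t c)) (mpow Ao (a * t)).
  by rewrite psg mpow_scale ?ltW // ?mpow_comp //; apply: mpow_psd.
have sg_psd : psd sg.
  by apply: psd_scale; [rewrite cR_ge0 ltW|rewrite -{2}(tA0 u); apply: psd_conj].
exists sg.
  split => //.
  rewrite -tr_ptr1 psg trOZ trA -cRM mulVf ?gt_eqF //.
move=> tau ht.
have hsJ : psd (ptr1 sg) by apply: psd_ptr1.
have oB : outO Bo = mulO (mulO (tensO Wn oneO) (outO rho)) (tensO Wn oneO).
  by rewrite /Bo outO_mulr outO_mull.
have osg : outO sg = scaleO (cR c) (mulO (mulO (tensO Au oneO) (outO Bo)) (tensO Au oneO)).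
  by rewrite /sg outO_scale outO_mulr outO_mull.
have oPB : mulO (tensO (mpow Ao 0) oneO) (outO Bo) = outO Bo by rewrite -outO_mull PB.
have oPBr : mulO (outO Bo) (tensO (mpow Ao 0) oneO) = outO Bo by rewrite -outO_mulr PBr.
have oBsg : outO Bo = scaleO (cR q) (mulO (mulO (tensO An oneO) (outO sg)) (tensO An oneO)).
  rewrite osg mulOZr mulOZl scaleOA -cRM mulfV ?gt_eqF // scale1O !mulOA tensM AnAu mulO1.
  by rewrite oPB -mulOA tensM AuAn mulO1 oPBr.
have orho : outO rho = mulO (mulO (tensO Wp oneO) (outO Bo)) (tensO Wp oneO).
  rewrite oB !mulOA tensM WpWn mulO1 -mulOA tensM WnWp mulO1.
  by rewrite -outO_mull Pr -outO_mulr Prr.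
have [Pta Ptt] := proj _ _ ht.
rewrite mpow_tens // sgJ mulr0 /powf c0 powRr0 scale1O => hs.
have Ptsg : mulO (tensO oneO (mpow tau 0)) (outO sg) = outO sg.
  by rewrite -{2}hs -{1}hs mulOA tensM mul1O Ptt.
split.
  (* [outO rho] is recovered from [outO sg] by multiplications on J alone, so the support condition
     on tau carries over; the projector of w is absorbed by [Wp]. *)
  rewrite mpow_tens // orho oBsg mulOZr mulOZl mulOZr; congr scaleO.
  rewrite !mulOA !tensM !mulO1 [mulO (mpow w 0) Wp]mpowD // add0r -/Wp.
  congr mulO; congr mulO.
  rewrite -{2}Ptsg mulOA tensM mulO1; congr mulO; congr tensO.
  by rewrite mul1O.
rewrite /Qsand.
(* The powers of A cancel to A^0, which [outO Bo] absorbs. The scalar c enters once from sigma and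
   twice as c^s from its marginal; the exponent is 1 + 2s = 1/a, so the a-th power scales Q by c =
   1/q. *)
have -> : sandw a (outO sg) (tensO (ptr1 sg) tau) =
    scaleO (cR (powf a^-1 c)) (sandw a (outO rho) (tensO w tau)).
  rewrite /sandw !mpow_tens // -/s sgJ as_u -/An osg tens_scalel.
  rewrite !(mulOZl, mulOZr) !scaleOA -!cRM; congr scaleO.
    congr cR; rewrite -{3}(powf1 (ltW c0)) !powfD; congr powf.
    by rewrite /s; field.
  rewrite !mulOA tensM AnAu mulO1 -(mulOA _ (tensO Au oneO)) tensM AuAn mul1O.
  have E1 : tensO (mpow Ao 0) (mpow tau s) = mulO (tensO oneO (mpow tau s)) (tensO (mpow Ao 0) oneO) :> Op R _.
    by rewrite tensM mul1O mulO1.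
  have E2 : tensO (mpow Ao 0) (mpow tau s) = mulO (tensO (mpow Ao 0) oneO) (tensO oneO (mpow tau s)) :> Op R _.
    by rewrite tensM mul1O mulO1.
  rewrite {1}E1 E2 -(mulOA _ (tensO _ _) (outO Bo)) oPB mulOA -(mulOA _ (outO Bo)) oPBr.
  rewrite oB !mulOA tensM mul1O mulO1 -(mulOA _ (tensO Wn oneO)).
  by rewrite (tensM Wn oneO) mul1O mulO1.
rewrite mpow_scale ?powf_ge0 //; last first.
  by apply: sandw_psd; [apply: outO_psd|apply: psd_tens].
rewrite trOZ Re_cRM powf_comp mulVf // powf1 ?ltW // mulrA mulfV ?gt_eqF //.
by rewrite mul1r.
Qed.
End Chan.
End Channels.

(** * The sequential process *)

Section Assembly.
Variable R : realType.
Local Notation C := R[i].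
Local Notation Re := (@complex.Re R).
Implicit Types T A B J : finType.

(** Regrouping tensor factors is a basis relabelling; along a bijection it commutes with functional
    calculus and preserves traces, hence Q. *)
Definition reidx {T T' : finType} (f : T' -> T) (X : Op R T) : Op R T' :=
  fun x y => X (f x) (f y).

Lemma tr_reidx {T T' : finType} (f : T' -> T) (X : Op R T) : bijective f ->
  trO (reidx f X) = trO X.
Proof. by move=> bf; rewrite /trO [RHS](reindex f) //; apply: onW_bij. Qed.

Lemma reidxM {T T' : finType} (f : T' -> T) (X Y : Op R T) : bijective f ->
  mulO (reidx f X) (reidx f Y) = reidx f (mulO X Y).
Proof.
move=> bf; apply: eqO => a b.
by rewrite /mulO /reidx [RHS](reindex f) //; apply: onW_bij.
Qed.

Lemma fcalc_reidx {T T' : finType} (f : T' -> T) (X : Op R T) h : bijective f ->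
  adjO X = X -> fcalc h (reidx f X) = reidx f (fcalc h X).
Proof.
move=> bf hX; have [p hp ->] := fcalcE h hX.
have hp' : specdec (reidx f X) (reidx f p.1, fun k => p.2 (f k)).
  case: (hp) => h1 ->; split => /= [k l|].
    rewrite -(inj_eq (bij_inj bf)) -h1 [RHS](reindex f) //; exact: onW_bij.
  apply: eqO => a b; rewrite /reidx [LHS](reindex f) //; exact: onW_bij.
rewrite (fcalc_spec _ hp'); apply: eqO => a b.
by rewrite /reidx /specfun [RHS](reindex f) //; apply: onW_bij.
Qed.

Lemma reidx_psd {T T' : finType} (f : T' -> T) (X : Op R T) : psd X -> psd (reidx f X).
Proof. exact: psd_pullback. Qed.

Lemma mpow_reidx {T T' : finType} (f : T' -> T) (X : Op R T) t : bijective f ->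
  psd X -> mpow (reidx f X) t = reidx f (mpow X t).
Proof. by move=> bf /psd_herm; apply: fcalc_reidx. Qed.

Lemma Qsand_reidx {T T' : finType} (f : T' -> T) a (X Y : Op R T) : bijective f ->
  psd X -> psd Y -> Qsand a (reidx f X) (reidx f Y) = Qsand a X Y.
Proof.
move=> bf hX hY; rewrite /Qsand.
have -> : sandw a (reidx f X) (reidx f Y) = reidx f (sandw a X Y).
  by rewrite /sandw (mpow_reidx _ bf hY) (reidxM (mpow Y _) X bf) (reidxM _ (mpow Y _) bf).
by rewrite (mpow_reidx _ bf (sandw_psd a hX hY)) tr_reidx.
Qed.

Lemma supp_reidx {T T' : finType} (f : T' -> T) (X Y : Op R T) : bijective f ->
  psd Y -> mulO (mpow Y 0) X = X -> mulO (mpow (reidx f Y) 0) (reidx f X) = reidx f X.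
Proof. by move=> bf hY h; rewrite mpow_reidx // reidxM // h. Qed.

(** * Logarithms and extended-real divergences *)

Lemma log2M (x y : R) : 0 < x -> 0 < y -> log2 (x * y) = log2 x + log2 y.
Proof. by move=> hx hy; rewrite /log2 lnM ?posrE // mulrDl. Qed.
Lemma log2_powR (x t : R) : log2 (x `^ t) = t * log2 x.
Proof. by rewrite /log2 ln_powR mulrA. Qed.
Lemma log2_ge0 (x : R) : 1 <= x -> 0 <= log2 x.
Proof. by move=> h; rewrite /log2 divr_ge0 ?ln_ge0 //; lra. Qed.
Lemma log2_1 : log2 (1 : R) = 0.
Proof. by rewrite /log2 ln1 mul0r. Qed.

Lemma Dsand_supp {T} (a : R) (rho sg : Op R T) : psd sg -> trO rho = 1 ->
  mulO (mpow sg 0) rho = rho -> Dsand a rho sg = (log2 (Qsand a rho sg) / (a - 1))%:E.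
Proof.
move=> hs r1 /(supp_subP rho hs) h; rewrite /Dsand; case: asboolP => // _.
by rewrite r1 divr1.
Qed.

(** Off the support the divergence is +oo, so a finite upper bound certifies the support
    condition. *)
Lemma Dsand_lt_supp {T} (a x : R) (rho sg : Op R T) : psd sg ->
  (Dsand a rho sg < x%:E)%E -> mulO (mpow sg 0) rho = rho.
Proof. by move=> hs; rewrite /Dsand; case: asboolP => // /(supp_subP rho hs). Qed.

Lemma Idown_ge0 {A B} (a : R) (rho : Op R (A * B)%type) : 1 < a -> dens_eq rho ->
  dens_le (ptr2 rho) -> (0 <= Idown a rho)%E.
Proof.
move=> ha [hr r1] hp; apply/ereal_infP => _ [tau [ht ->]].
have hs := dens_le_tens hp ht; have [hs0 _] := hs.
have [h|h] := pselect (supp_sub rho (tensO (ptr2 rho) tau)); last first.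
  by rewrite /Dsand; case: asboolP => // _; rewrite leey.
move: h => /(supp_subP _ hs0) h; rewrite Dsand_supp // lee_fin.
apply: divr_ge0; last by rewrite subr_ge0 ltW.
by apply/log2_ge0/Qsand_ge1.
Qed.

Section Chain.
Variables (n : nat) (Rg L : nat -> finType) (S E : finType).
Variable M : forall k : nat, Op R (Rg k) -> Op R (Rg k.+1 * L k.+1)%type.
Arguments M : clear implicits.
Variables (rho : Op R (Rg 0 * (S * E))%type) (a : R).
Hypotheses (chM : forall k, (k < n)%N -> channel (M k)) (hrho : dens_eq rho) (ha : 1 < a).

Local Notation X k := (seqstate M rho k).

(** [Jreg] nests the newest L register inside the block of L registers, whereas [out_JL] places it
    last. *)
Definition Jsplit k (y : Jreg L S E k.+1) : (Jreg L S E k * L k.+1)%type :=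
  ((y.1.1, y.2), y.1.2).

Lemma Jsplit_bij k : bijective (@Jsplit k).
Proof.
exists (fun z : (Jreg L S E k * L k.+1)%type => ((z.1.1, z.2), z.1.2) : Jreg L S E k.+1).
  by move=> [[]].
by move=> [[]].
Qed.

Lemma ptr1_step k : ptr1 (X k.+1) = reidx (@Jsplit k) (outO (M k) (X k)).
Proof. by []. Qed.

Lemma tr_one_unit : trO (@oneO R unit) = 1.
Proof. by rewrite /trO big_const /= card_unit /= addr0. Qed.

Lemma ptr1_seqstate0 : tensO oneO (ptr1 rho) = ptr1 (X 0) :> Op R (unit * (S * E))%type.
Proof. by apply: eqO => -[[] x] [[] y]; rewrite /tensO /oneO /= mul1r. Qed.

Lemma seqstate_dens k : (k <= n)%N -> dens_eq (X k).
Proof.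
elim: k => [_|k IH kn].
  have [h r1] := hrho; split.
    exact: (psd_pullback (fun y : Rg 0 * Jreg L S E 0 => (y.1, y.2.2)) h).
  by rewrite -tr_ptr1 -ptr1_seqstate0 tr_tens tr_one_unit mul1r tr_ptr1.
have [h r1] := IH (ltnW kn); have ch := chM kn; split.
  have [_ [cp _]] := ch.
  exact: (psd_pullback (fun y : Rg k.+1 * Jreg L S E k.+1 =>
    ((y.1, y.2.1.2), (y.2.1.1, y.2.2))) (cp _ _ h)).
by rewrite -tr_ptr1 ptr1_step tr_reidx ?tr_outO //; apply: Jsplit_bij.
Qed.

Lemma out_dens k (sg : Op R (Rg k * Jreg L S E k)%type) : (k < n)%N -> dens_eq sg ->
  dens_eq (outO (M k) sg).
Proof. by move=> kn [h r1]; have ch := chM kn; split; [apply: outO_psd|rewrite tr_outO]. Qed.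

Lemma dens_ptr1 {A B} (Z : Op R (A * B)%type) : dens_eq Z -> dens_le (ptr1 Z).
Proof. by move=> [h r1]; split; [exact: psd_ptr1|rewrite tr_ptr1 r1]. Qed.

(** Keeps -oo out of the final sum. The actual state of the process witnesses that the supremum
    ranges over a nonempty set. *)
Lemma chan_term_ge0 k : (k < n)%N -> (0 <= chan_term S E a (M k))%E.
Proof.
move=> kn; have h := seqstate_dens (ltnW kn); apply: le_ereal_sup_tmp.
exists (Idown a (out_JL (M k) (X k))); first by exists (X k).
apply: Idown_ge0 => //; first exact: out_dens.
by rewrite (ptr2_outO (chM kn)); apply: dens_ptr1.
Qed.

(** The S E factor of the reference stays rho_SE and only its L part grows. The support condition is
    part of the induction because [chain_step] consumes it. The slack eta pays for an infimum over
    tau that may not be attained. *)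
Lemma chain_bound (c : nat -> R) (eta : R) : 0 < eta ->
  (forall k, (k < n)%N -> (chan_term S E a (M k) <= (c k)%:E)%E) ->
  forall k, (k <= n)%N -> exists sL : Op R (Lcat L k),
  [/\ dens_le sL,
      mulO (mpow (tensO sL (ptr1 rho)) 0) (ptr1 (X k)) = ptr1 (X k) &
      log2 (Qsand a (ptr1 (X k)) (tensO sL (ptr1 rho))) / (a - 1) <=
        \sum_(i < k) (c i + eta)].
Proof.
move=> eta0 hc; have hSE := dens_ptr1 hrho; have [hSE0 _] := hSE.
have a1 : 0 < a - 1 by rewrite subr_gt0.
elim=> [_|k IH kn].
  exists oneO; rewrite big_ord0.
  have wE := ptr1_seqstate0.
  have hw : psd (tensO (@oneO R unit) (ptr1 rho)) by apply: psd_tens => //; apply: psd_id.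
  split.
  - by split; [exact: psd_id|rewrite tr_one_unit].
  - by rewrite -wE suppM.
  (* State and reference coincide: the exponents of the sandwich add up to 1/a, and the a-th power
     returns a state of trace 1. *)
  - have -> : Qsand a (ptr1 (X 0)) (tensO oneO (ptr1 rho)) = 1.
      rewrite -wE /Qsand /sandw -{2}(mpow1 hw) !mpowD // mpow_comp //.
      have a0 : a != 0 by lra.
      rewrite (_ : _ * a = 1); last by field; lra.
      rewrite mpow1 // wE tr_ptr1; have [_ ->] := seqstate_dens (leq0n n).
      by [].
    by rewrite log2_1 mul0r.
have [sL [hsL hs hQ]] := IH (ltnW kn).
have hX := seqstate_dens (ltnW kn).
have ch := chM kn.
set w := tensO sL (ptr1 rho) in hs hQ *.
have hw : dens_le w by apply: dens_le_tens.
have [sg hsg hstep] := chain_step ch ha hX hw hs.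
have [hsg0 sg1] := hsg.
have hI : (Idown a (out_JL (M k) sg) < (c k + eta)%:E)%E.
  apply: (@le_lt_trans _ _ (c k)%:E); last by rewrite lte_fin ltrDl.
  apply: le_trans (hc k kn); apply: le_ereal_sup_tmp.
  by exists (Idown a (out_JL (M k) sg)) => //; exists sg.
have [_ [tau [htau ->]]] := ereal_inf_lt hI.
rewrite (ptr2_outO ch) -[out_JL _ _]/(outO (M k) sg) => hD.
have [hta _] := htau.
have [hsgJ _] := dens_ptr1 hsg.
have hst : dens_le (tensO (ptr1 sg) tau) by apply: dens_le_tens => //; apply: dens_ptr1.
have hsupp := Dsand_lt_supp (proj1 hst) hD.
have [ho0 o1] := out_dens kn hsg.
move: hD; rewrite (Dsand_supp _ (proj1 hst) o1 hsupp) lte_fin => hD.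
have [hsupp' hQE] := hstep tau hta hsupp.
have hwt : psd (tensO w tau) by apply: psd_tens => //; case: hw.
exists (tensO sL tau).
have wE : tensO (tensO sL tau) (ptr1 rho) = reidx (@Jsplit k) (tensO w tau).
  by apply: eqO => -[[l1 l2] x] [[l1' l2'] x']; rewrite /reidx /w /tensO /=; ring.
split; first exact: dens_le_tens.
  by rewrite wE ptr1_step; apply: supp_reidx => //; apply: Jsplit_bij.
rewrite wE ptr1_step Qsand_reidx //; [|exact: Jsplit_bij|by apply: outO_psd => //; case: hX].
rewrite hQE log2M; last 2 first.
- apply: lt_le_trans ltr01 _; apply: Qsand_ge1 => //; last by rewrite tr_ptr1; case: hX.
  by apply: psd_ptr1; case: hX.
- by apply: lt_le_trans ltr01 _; apply: Qsand_ge1.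
by rewrite mulrDl big_ord_recr /= lerD // ltW.
Qed.

Lemma Imax_bound (eps B : R) (sL : Op R (Lcat L n)) : 0 <= eps -> eps < 1 ->
  1 - Num.sqrt (1 - eps ^+ 2) != 0 -> dens_le sL ->
  mulO (mpow (tensO sL (ptr1 rho)) 0) (ptr1 (X n)) = ptr1 (X n) ->
  log2 (Qsand a (ptr1 (X n)) (tensO sL (ptr1 rho))) / (a - 1) <= B ->
  (Imax_dd eps (final_SE_L M rho n) <=
   (B - log2 (1 - Num.sqrt (1 - eps ^+ 2)) / (a - 1))%:E)%E.
Proof.
move=> e0 e1 d0 hsL hs hB; set d := 1 - Num.sqrt _ in d0 *.
have a1 : 0 < a - 1 by rewrite subr_gt0.
have dpos : 0 < d.
  rewrite lt_def d0 subr_ge0 -{2}sqrtr1 ler_wsqrtr //.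
  by rewrite lerBlDr lerDl sqr_ge0.
have hSE := dens_ptr1 hrho.
pose sw (y : (S * E) * Lcat L n) : Jreg L S E n := (y.2, y.1).
have bsw : bijective sw by exists (fun z => (z.2, z.1)); move=> [].
have [hX0 X1] := seqstate_dens (leqnn n).
have hXJ : psd (ptr1 (X n)) by apply: psd_ptr1.
have fE : final_SE_L M rho n = reidx sw (ptr1 (X n)) by [].
set w := tensO sL (ptr1 rho) in hs hB.
have hwd : dens_le w by apply: dens_le_tens.
have hw : psd w by case: hwd.
have wE : reidx sw w = tensO (ptr1 rho) sL.
  by apply: eqO => -[x l] [x' l']; rewrite /reidx /w /tensO /= mulrC.
set Q := Qsand a (ptr1 (X n)) w in hB.
have Q1 : 1 <= Q by apply: Qsand_ge1 => //; rewrite tr_ptr1.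
have Q0 : 0 < Q by lra.
(* The solution of l^(1-a) Q = d; its logarithm is (log Q - log d) / (a - 1). *)
pose l := (Q / d) `^ (a - 1)^-1.
have l0 : 0 < l by rewrite powR_gt0 // divr_gt0.
have lE : l `^ (1 - a) * Qsand a (final_SE_L M rho n) (tensO (ptr1 rho) sL) = d.
  rewrite -wE fE Qsand_reidx // -/Q /l -powRrM.
  have -> : (a - 1)^-1 * (1 - a) = -1 by field; lra.
  rewrite powR_inv1 ?divr_ge0 ?ltW // invfM invrK mulrAC mulVf ?mul1r //.
  by rewrite gt_eqF.
have tf : trO (final_SE_L M rho n) = 1 by rewrite fE tr_reidx // tr_ptr1.
have [|||rt [h1 h2 h3]] := smooth_bound ha _ tf _ _ l0 lE.
- by rewrite fE; apply: reidx_psd.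
- by rewrite -wE; apply: reidx_psd.
- by rewrite -wE fE; apply: supp_reidx.
apply: (@le_trans _ _ (Idd_inf rt)).
  apply: ge_ereal_inf; exists (Idd_inf rt) => //; exists rt; split => //; split => //.
  (* Since 1 - d = sqrt(1 - eps^2), the fidelity bound is exactly the one needed for purified
     distance eps. *)
  rewrite /pdist -[leRHS](ger0_norm e0) -sqrtr_sqr ler_wsqrtr // lerBlDr -lerBlDl.
  have h4 : Num.sqrt (1 - eps ^+ 2) <= gfid rt (final_SE_L M rho n).
    by move: h3; rewrite /d opprB addrCA subrr addr0.
  have e2 : 0 <= 1 - eps ^+ 2 by rewrite subr_ge0 expr_le1 // ltW.
  by rewrite -[leLHS](sqr_sqrtr e2) ler_sqr ?nnegrE ?sqrtr_ge0 // (le_trans _ h4) ?sqrtr_ge0.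
apply: (@le_trans _ _ (Dmax rt (tensO (ptr1 rho) sL))).
  by apply: ge_ereal_inf; exists (Dmax rt (tensO (ptr1 rho) sL)) => //; exists (ptr1 rho), sL.
apply: (@le_trans _ _ (log2 l)%:E).
  by apply: ge_ereal_inf; exists (log2 l)%:E => //; exists l.
rewrite lee_fin /l log2_powR log2M ?invr_gt0 //.
have -> : log2 d^-1 = - log2 d by rewrite /log2 lnV ?posrE // mulNr.
by rewrite mulrBr ![(a - 1)^-1 * _]mulrC lerD2r.
Qed.

End Chain.
End Assembly.

Unset Implicit Arguments.

Theorem mainTheorem7 (R : realType) (n : nat) (Rg L : nat -> finType) (S E : finType)
  (M : forall k : nat, Op R (Rg k) -> Op R (Rg k.+1 * L k.+1)%type)
  (rho : Op R (Rg 0 * (S * E))%type) (eps alpha : R) :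
  (forall k : nat, (k < n)%N -> channel (M k)) ->
  dens_eq rho ->
  0 <= eps -> eps < 1 -> 1 < alpha ->
  (Imax_dd eps (final_SE_L M rho n) <=
   \sum_(k < n) chan_term S E alpha (M k) - gE eps * ((alpha - 1)^-1)%:E)%E.
Proof.
move=> chM hrho e0 e1 ha.
have a1 : 0 < alpha - 1 by rewrite subr_gt0.
have t0 (k : 'I_n) : (0 <= chan_term S E alpha (M k))%E.
  exact: (chan_term_ge0 chM hrho ha (ltn_ord k)).
have sum0 : (0 <= \sum_(k < n) chan_term S E alpha (M k))%E by apply: sume_ge0.
rewrite /gE; case: eqP => [_|/eqP d0].
  (* Case eps = 0: the last term is +oo, and the nonnegative sum cannot cancel it. *)
  rewrite gt0_mulNye ?lte_fin ?invr_gt0 //= addey ?leey //.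
  by rewrite -ltNye (lt_le_trans _ sum0) // ltNy0.
(* One infinite summand makes the right-hand side +oo, all summands being nonnegative; otherwise
   every term is a real number. *)
have [fin|/existsNP[k]] := pselect (forall k : 'I_n, chan_term S E alpha (M k) \is a fin_num); last first.
  move=> /negP; rewrite ge0_fin_numE // -leNgt leye_eq => /eqP hk.
  suff -> : (\sum_(k < n) chan_term S E alpha (M k) = +oo)%E by rewrite -EFinM -EFinN addye ?leey.
  apply/esum_eqyP => [i _|]; first by rewrite -ltNye (lt_le_trans _ (t0 i)) // ltNy0.
  by exists k; rewrite mem_index_enum.
pose c k := fine (chan_term S E alpha (M k)).
have cE (k : nat) : (k < n)%N -> chan_term S E alpha (M k) = (c k)%:E.
  by move=> kn; rewrite fineK // (fin (Ordinal kn)).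
have -> : (\sum_(k < n) chan_term S E alpha (M k) = (\sum_(k < n) c k)%:E)%E.
  by rewrite -sumEFin; apply: eq_bigr => k _; apply: cE.
apply/lee_addgt0Pr => e he.
(* The n slacks add up to at most e; dividing by n + 1 also covers n = 0. *)
pose eta := e / n.+1%:R.
have eta0 : 0 < eta by rewrite divr_gt0.
have hc k : (k < n)%N -> (chan_term S E alpha (M k) <= (c k)%:E)%E by move=> kn; rewrite cE.
have [sL [h1 h2 h3]] := chain_bound chM hrho ha eta0 hc (leqnn n).
apply: le_trans (Imax_bound chM hrho ha e0 e1 d0 h1 h2 h3) _.
rewrite -EFinM -EFinN -!EFinD lee_fin [leRHS]addrAC lerD2r.
rewrite big_split /= lerD2l sumr_const card_ord -mulr_natr /eta -mulrA.
rewrite ler_piMr ?(ltW he) // mulrC ler_pdivrMr ?ltr0n // mul1r ler_nat //.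
Qed.
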